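(* Let $A_\infty>B$ and $h_0>h_2$, where $$h_2=\frac{B-C}{A_{\infty}-B}\sqrt{\frac{k_2k_3c_2}{\pi c_3\alpha_3}}\;\frac{1}{\operatorname{erf}\left(z_0\sqrt{\alpha_1/\alpha_2}\right)}.$$ Then there exists a unique similarity-type solution $(v_1,v_2,v_3,w_1,w_2)$ of the three-phase Stefan problem (P1) with convective boundary condition at $x=0$. It is given, for $t>0$, by $$v_3(x,t)=\frac{\frac{Bk_3}{h_0\sqrt{\pi\alpha_3}}+A_\infty\operatorname{erf}\left(\xi_2\sqrt{\frac{\alpha_1}{\alpha_3}}\right)-(A_\infty-B)\operatorname{erf}\left(\frac{x}{2\sqrt{\alpha_3t}}\right)}{\frac{k_3}{h_0\sqrt{\pi\alpha_3}}+\operatorname{erf}\left(\xi_2\sqrt{\frac{\alpha_1}{\alpha_3}}\right)},\quad 0<x<w_2(t),$$ $$v_2(x,t)=\frac{-C\operatorname{erf}\left(\xi_2\sqrt{\frac{\alpha_1}{\alpha_2}}\right)+B\operatorname{erf}\left(\xi_1\sqrt{\frac{\alpha_1}{\alpha_2}}\right)-(B-C)\operatorname{erf}\left(\frac{x}{2\sqrt{\alpha_2t}}\right)}{\operatorname{erf}\left(\xi_1\sqrt{\frac{\alpha_1}{\alpha_2}}\right)-\operatorname{erf}\left(\xi_2\sqrt{\frac{\alpha_1}{\alpha_2}}\right)},\quad w_2(t)<x<w_1(t),$$ $$v_1(x,t)=\frac{C\left(1-\operatorname{erf}\left(\frac{x}{2\sqrt{\alpha_1t}}\right)\right)+D\left(\operatorname{erf}\left(\frac{x}{2\sqrt{\alpha_1t}}\right)-\operatorname{erf}(\xi_1)\right)}{\operatorname{erfc}(\xi_1)},\quad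 x>w_1(t),$$ $$w_2(t)=2\xi_2\sqrt{\alpha_1t},\qquad w_1(t)=2\xi_1\sqrt{\alpha_1t},$$ where $\xi_2=\sqrt{\frac{\alpha_2}{\alpha_1}}\operatorname{erf}^{-1}(H(\xi_1))$ and $\xi_1$ is the unique solution $z$ of the equation $$Q(z)=T\left(\sqrt{\tfrac{\alpha_2}{\alpha_1}}\operatorname{erf}^{-1}(H(z))\right),\qquad z>z_0.$$
   Context: Data: positive constants $\rho$, $k_i,c_i$ ($i=1,2,3$), $\ell_1,\ell_2$; $\alpha_i=\frac{k_i}{\rho c_i}$, $\delta_i=\rho\ell_i$ ($i=1,2$); it is assumed that $\alpha_2>\alpha_3$. Real temperatures $B>C>D$, $A_\infty>B$, and a constant $h_0>0$. Problem (P1): find temperatures $\Phi_3$ (on $0<x<y_2(t)$), $\Phi_2$ (on $y_2(t)<x<y_1(t)$), $\Phi_1$ (on $x>y_1(t)$) and free boundaries $y_1,y_2$ such that, for $t>0$: $\partial_t\Phi_i=\alpha_i\,\partial_{xx}\Phi_i$ in the respective region ($i=1,2,3$); $\Phi_3(y_2(t),t)=\Phi_2(y_2(t),t)=B$; $\Phi_2(y_1(t),t)=\Phi_1(y_1(t),t)=C$; $\Phi_1(x,0)=\Phi_1(+\infty,t)=D$ (understood as limits as $t\to0^+$ and $x\to+\infty$); $k_2\partial_x\Phi_2(y_2(t),t)-k_3\partial_x\Phi_3(y_2(t),t)=\delta_2\dot y_2(t)$; $k_1\partial_x\Phi_1(y_1(t),t)-k_2\partial_x\Phi_2(y_1(t),t)=\delta_1\dot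 y_1(t)$; $y_1(0)=y_2(0)=0$; and the convective (Robin) condition $k_3\partial_x\Phi_3(0,t)=\frac{h_0}{\sqrt t}\left(\Phi_3(0,t)-A_\infty\right)$. A similarity-type solution is one of the form $\Phi_i(x,t)=A_i+B_i\operatorname{erf}\left(\frac{x}{2\sqrt{\alpha_it}}\right)$ ($i=1,2,3$, $A_i,B_i$ real constants) and $y_i(t)=2\xi_i\sqrt{\alpha_1t}$ ($i=1,2$) with constants $0<\xi_2<\xi_1$. Functions: $\operatorname{erf}$ and $\operatorname{erfc}=1-\operatorname{erf}$ are the error and complementary error functions, and $\operatorname{erf}^{-1}:(-1,1)\to\mathbb R$ is the inverse of $\operatorname{erf}$. Put $\mathrm{Ste}_1=\frac{c_1(C-D)}{\ell_1}$, $\mathrm{Ste}_2=\frac{c_2(B-C)}{\ell_2}$, and for $z\ge0$: $$\varphi(z)=z+\frac{\mathrm{Ste}_1}{\sqrt\pi}\frac{\exp(-z^2)}{\operatorname{erfc}(z)},\qquad H(z)=\operatorname{erf}\left(z\sqrt{\tfrac{\alpha_1}{\alpha_2}}\right)-\frac{\mathrm{Ste}_2}{\sqrt\pi}\frac{\ell_2}{\ell_1}\sqrt{\frac{k_2c_1}{k_1c_2}}\,\frac{\exp\left(-z^2\frac{\alpha_1}{\alpha_2}\right)}{\varphi(z)},$$ $$Q(z)=\frac{\ell_1}{\ell_2}\varphi(z)\exp\left(z^2\tfrac{\alpha_1}{\alpha_2}\right),$$ $$T(z)=\frac{\mathrm{Ste}_2}{\sqrt\pi\,c_2}\frac{A_\infty-B}{B-C}\sqrt{\frac{k_3c_1c_3}{k_1}}\;\frac{\exp\left(-z^2\alpha_1\left(\frac1{\alpha_3}-\frac1{\alpha_2}\right)\right)}{\frac{k_3}{h_0\sqrt{\pi\alpha_3}}+\operatorname{erf}\left(z\sqrt{\frac{\alpha_1}{\alpha_3}}\right)}-z\exp\left(z^2\tfrac{\alpha_1}{\alpha_2}\right).$$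 $H$ is increasing with $H(0)<0$ and $H(+\infty)=1$; $z_0>0$ denotes its unique zero, $H(z_0)=0$. *)

(* Defs.v *)
From Stdlib Require Import Reals ClassicalEpsilon.
From Coquelicot Require Import Coquelicot.

Open Scope R_scope.

Definition erf (x : R) : R := 2 / sqrt PI * RInt (fun u => exp (- u ^ 2)) 0 x.

Definition erfc (x : R) : R := 1 - erf x.

(* Inverse of erf, meaningful on (-1, 1) only; unspecified elsewhere. *)
Definition erfinv (y : R) : R := epsilon (inhabits 0) (fun x => erf x = y).

(* rho: density; k_i, c_i: conductivities and specific heats; l_i: latent heats;
   tB, tC: phase-change temperatures; tD: initial temperature;
   Ainf: bulk temperature and h0: heat-transfer coefficient at x = 0. *)
Record stefan_data := StefanData {
  rho : R;
  k1 : R; k2 : R; k3 : R;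
  c1 : R; c2 : R; c3 : R;
  l1 : R; l2 : R;
  tB : R; tC : R; tD : R;
  Ainf : R;
  h0 : R
}.

Definition alpha1 (d : stefan_data) : R := k1 d / (rho d * c1 d).
Definition alpha2 (d : stefan_data) : R := k2 d / (rho d * c2 d).
Definition alpha3 (d : stefan_data) : R := k3 d / (rho d * c3 d).
Definition delta1 (d : stefan_data) : R := rho d * l1 d.
Definition delta2 (d : stefan_data) : R := rho d * l2 d.
Definition Ste1 (d : stefan_data) : R := c1 d * (tC d - tD d) / l1 d.
Definition Ste2 (d : stefan_data) : R := c2 d * (tB d - tC d) / l2 d.

Record admissible (d : stefan_data) : Prop := Admissible {
  rho_pos : 0 < rho d;
  k1_pos : 0 < k1 d; k2_pos : 0 < k2 d; k3_pos : 0 < k3 d;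
  c1_pos : 0 < c1 d; c2_pos : 0 < c2 d; c3_pos : 0 < c3 d;
  l1_pos : 0 < l1 d; l2_pos : 0 < l2 d;
  h0_pos : 0 < h0 d;
  tC_lt_tB : tC d < tB d;
  tD_lt_tC : tD d < tC d;
  alpha3_lt_alpha2 : alpha3 d < alpha2 d
}.

(* The heat equation u_t = a u_xx at (x, t), in the classical sense.  The second
   conjunct is needed because [ex_derive_n _ 2 x] is about the total function
   [Derive] and does not itself imply differentiability at x. *)
Definition heat_eq (a : R) (u : R -> R -> R) (x t : R) : Prop :=
  ex_derive (fun s => u x s) t /\
  ex_derive (fun z => u z t) x /\
  ex_derive_n (fun z => u z t) 2 x /\
  Derive (fun s => u x s) t = a * Derive_n (fun z => u z t) 2 x.

(* Each temperature matters only on its open region, so its value and its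
   x-derivative at a boundary point are traces: limits at time t along F, which
   is [at_left p] or [at_right p] according to the side of the region. *)
Definition trace (u : R -> R -> R) (t : R) (F : (R -> Prop) -> Prop) (l : R) : Prop :=
  filterlim (fun x => u x t) F (locally l).

Definition dx (u : R -> R -> R) (x t : R) : R := Derive (fun z => u z t) x.

Record solves_P1 (d : stefan_data) (Phi1 Phi2 Phi3 : R -> R -> R) (y1 y2 : R -> R)
    : Prop := SolvesP1 {
  (* ordering of the phases, implicit in the regions of the problem *)
  P1_order : forall t, 0 < t -> 0 < y2 t < y1 t;
  P1_heat3 : forall t x, 0 < t -> 0 < x < y2 t -> heat_eq (alpha3 d) Phi3 x t;
  P1_heat2 : forall t x, 0 < t -> y2 t < x < y1 t -> heat_eq (alpha2 d) Phi2 x t;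
  P1_heat1 : forall t x, 0 < t -> y1 t < x -> heat_eq (alpha1 d) Phi1 x t;
  P1_front2 : forall t, 0 < t ->
    trace Phi3 t (at_left (y2 t)) (tB d) /\ trace Phi2 t (at_right (y2 t)) (tB d);
  P1_front1 : forall t, 0 < t ->
    trace Phi2 t (at_left (y1 t)) (tC d) /\ trace Phi1 t (at_right (y1 t)) (tC d);
  P1_initial : forall x, 0 < x ->
    filterlim (fun t => Phi1 x t) (at_right 0) (locally (tD d));
  P1_infinity : forall t, 0 < t -> is_lim (fun x => Phi1 x t) p_infty (tD d);
  P1_stefan2 : forall t, 0 < t -> exists g2 g3,
    trace (dx Phi2) t (at_right (y2 t)) g2 /\
    trace (dx Phi3) t (at_left (y2 t)) g3 /\
    ex_derive y2 t /\
    k2 d * g2 - k3 d * g3 = delta2 d * Derive y2 t;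
  P1_stefan1 : forall t, 0 < t -> exists g1 g2,
    trace (dx Phi1) t (at_right (y1 t)) g1 /\
    trace (dx Phi2) t (at_left (y1 t)) g2 /\
    ex_derive y1 t /\
    k1 d * g1 - k2 d * g2 = delta1 d * Derive y1 t;
  P1_start : y1 0 = 0 /\ y2 0 = 0;
  P1_robin : forall t, 0 < t -> exists p g,
    trace Phi3 t (at_right 0) p /\
    trace (dx Phi3) t (at_right 0) g /\
    k3 d * g = h0 d / sqrt t * (p - Ainf d)
}.

Definition similarity_type (d : stefan_data) (Phi1 Phi2 Phi3 : R -> R -> R)
    (y1 y2 : R -> R) : Prop :=
  (exists xi1 xi2, 0 < xi2 < xi1 /\
    forall t, 0 <= t ->
      y1 t = 2 * xi1 * sqrt (alpha1 d * t) /\ y2 t = 2 * xi2 * sqrt (alpha1 d * t)) /\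
  (exists A1 B1, forall t x, 0 < t -> y1 t < x ->
    Phi1 x t = A1 + B1 * erf (x / (2 * sqrt (alpha1 d * t)))) /\
  (exists A2 B2, forall t x, 0 < t -> y2 t < x < y1 t ->
    Phi2 x t = A2 + B2 * erf (x / (2 * sqrt (alpha2 d * t)))) /\
  (exists A3 B3, forall t x, 0 < t -> 0 < x < y2 t ->
    Phi3 x t = A3 + B3 * erf (x / (2 * sqrt (alpha3 d * t)))).

Definition similarity_solution (d : stefan_data) (Phi1 Phi2 Phi3 : R -> R -> R)
    (y1 y2 : R -> R) : Prop :=
  similarity_type d Phi1 Phi2 Phi3 y1 y2 /\ solves_P1 d Phi1 Phi2 Phi3 y1 y2.

Definition phi (d : stefan_data) (z : R) : R :=
  z + Ste1 d / sqrt PI * (exp (- z ^ 2) / erfc z).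

Definition Hfun (d : stefan_data) (z : R) : R :=
  erf (z * sqrt (alpha1 d / alpha2 d))
  - Ste2 d / sqrt PI * (l2 d / l1 d) * sqrt (k2 d * c1 d / (k1 d * c2 d))
    * (exp (- z ^ 2 * (alpha1 d / alpha2 d)) / phi d z).

Definition Qfun (d : stefan_data) (z : R) : R :=
  l1 d / l2 d * phi d z * exp (z ^ 2 * (alpha1 d / alpha2 d)).

Definition Tfun (d : stefan_data) (z : R) : R :=
  Ste2 d / (sqrt PI * c2 d) * ((Ainf d - tB d) / (tB d - tC d))
  * sqrt (k3 d * c1 d * c3 d / k1 d)
  * (exp (- z ^ 2 * alpha1 d * (1 / alpha3 d - 1 / alpha2 d))
     / (k3 d / (h0 d * sqrt (PI * alpha3 d)) + erf (z * sqrt (alpha1 d / alpha3 d))))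
  - z * exp (z ^ 2 * (alpha1 d / alpha2 d)).

Definition h2 (d : stefan_data) (z0 : R) : R :=
  (tB d - tC d) / (Ainf d - tB d)
  * sqrt (k2 d * k3 d * c2 d / (PI * c3 d * alpha3 d))
  * (1 / erf (z0 * sqrt (alpha1 d / alpha2 d))).

Definition v3 (d : stefan_data) (xi2 x t : R) : R :=
  let m := k3 d / (h0 d * sqrt (PI * alpha3 d)) in
  let e2 := erf (xi2 * sqrt (alpha1 d / alpha3 d)) in
  (tB d * m + Ainf d * e2
   - (Ainf d - tB d) * erf (x / (2 * sqrt (alpha3 d * t)))) / (m + e2).

Definition v2 (d : stefan_data) (xi1 xi2 x t : R) : R :=
  let e1 := erf (xi1 * sqrt (alpha1 d / alpha2 d)) in
  let e2 := erf (xi2 * sqrt (alpha1 d / alpha2 d)) in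
  (- tC d * e2 + tB d * e1
   - (tB d - tC d) * erf (x / (2 * sqrt (alpha2 d * t)))) / (e1 - e2).

Definition v1 (d : stefan_data) (xi1 x t : R) : R :=
  let e := erf (x / (2 * sqrt (alpha1 d * t))) in
  (tC d * (1 - e) + tD d * (e - erf xi1)) / erfc xi1.

Definition front (d : stefan_data) (xi t : R) : R := 2 * xi * sqrt (alpha1 d * t).

(* Equality of two candidate solutions on their domains of definition. *)
Definition same_solution (Phi1 Phi2 Phi3 : R -> R -> R) (y1 y2 : R -> R)
    (Psi1 Psi2 Psi3 : R -> R -> R) (s1 s2 : R -> R) : Prop :=
  (forall t, 0 <= t -> y1 t = s1 t /\ y2 t = s2 t) /\
  (forall t x, 0 < t -> s1 t < x -> Phi1 x t = Psi1 x t) /\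
  (forall t x, 0 < t -> s2 t < x < s1 t -> Phi2 x t = Psi2 x t) /\
  (forall t x, 0 < t -> 0 < x < s2 t -> Phi3 x t = Psi3 x t).

(* Main.v *)
(** The heat equations, the limits at infinity and at time 0, and the Dirichlet and Robin
    conditions determine all the coefficients [A_i], [B_i] from [xi1] and [xi2].  The two
    Stefan conditions, in which [1 / sqrt t] factors out, then become [H xi1 = erf (xi2 r)]
    with [r = sqrt (alpha1 / alpha2)], and [Q xi1 = T xi2].  As [H] increases from [H z0 = 0]
    and stays below 1, the first one defines [xi2] as an increasing function of [xi1 > z0].
    Since [Q] increases to infinity and [T] decreases, the second one has exactly one root
    as soon as [Q z0 < T 0], and this inequality is [h0 > h2].

    The monotonicity of [phi] rests on [sqrt PI * z * erfc z <= exp (- z ^ 2)], the bounds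
    on [erf] on the Gaussian integral. *)

From Stdlib Require Import Reals Lra FunctionalExtensionality ClassicalEpsilon.
From Coquelicot Require Import Coquelicot.
Require Import Defs.
Open Scope R_scope.


(** * The error function *)

(** The threshold [h2] comes from comparing two explicit values. At 0 the [erf] in the denominator
    of [T] vanishes, so [T 0 = (Ainf - tB) * h0 / (rho * l2 * sqrt alpha1)] is linear in [h0], while
    [H z0 = 0] turns [Q z0] into [(tB - tC) * flux k2 alpha2 / (rho * l2 * sqrt alpha1 * erf (z0 *
    r))]. The assumption [alpha3 < alpha2] fixes the sign of the exponent in [T], hence the decrease
    of [T]. For uniqueness, a competing solution is known only on its open regions, so its boundary
    values enter as one-sided limits. Its coefficients do not depend on time, and reading these
    limits at [t = 1] recovers every equation. That its [xi1] exceeds [z0] is a consequence of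
    [xi2 > 0], which makes [H xi1 = erf (xi2 * r)] positive. *)

Lemma continuous_gauss (x : R) : continuous (fun u => exp (- u ^ 2)) x.
Proof.
  apply (@ex_derive_continuous R_AbsRing R_NormedModule (fun u => exp (- u ^ 2))).
  auto_derive; trivial.
Qed.

Lemma ex_RInt_gauss (a b : R) : ex_RInt (fun u => exp (- u ^ 2)) a b.
Proof. apply (@ex_RInt_continuous R_CompleteNormedModule); intros; apply continuous_gauss. Qed.

Lemma is_derive_RInt_gauss (x : R) :
  is_derive (fun y => RInt (fun u => exp (- u ^ 2)) 0 y) x (exp (- x ^ 2)).
Proof.
  apply (@is_derive_RInt R_NormedModule (fun u => exp (- u ^ 2))) with 0.
  - apply filter_forall; intros y.
    apply (@RInt_correct R_CompleteNormedModule), ex_RInt_gauss.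
  - apply continuous_gauss.
Qed.

(* Differentiating [x |-> int_0^1 exp(-x^2 (1+s^2)) / (1+s^2) ds] cancels the derivative of
   the square of [int_0^x exp(-u^2) du]. *)
Definition gauss_aux (x : R) : R :=
  RInt (fun s => exp (- (x ^ 2 * (1 + s ^ 2))) / (1 + s ^ 2)) 0 1.

Lemma one_plus_sqr_pos (s : R) : 0 < 1 + s ^ 2.
Proof. assert (h := pow2_ge_0 s); lra. Qed.

Lemma ex_RInt_gauss_aux (x a b : R) :
  ex_RInt (fun s => exp (- (x ^ 2 * (1 + s ^ 2))) / (1 + s ^ 2)) a b.
Proof.
  apply (@ex_RInt_continuous R_CompleteNormedModule); intros s _.
  apply (@ex_derive_continuous R_AbsRing R_NormedModule
           (fun s => exp (- (x ^ 2 * (1 + s ^ 2))) / (1 + s ^ 2))).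
  auto_derive. assert (h := one_plus_sqr_pos s); simpl in h; lra.
Qed.

Lemma exp_le_exp (x y : R) : x <= y -> exp x <= exp y.
Proof. intros [h | ->]; [apply Rlt_le, exp_increasing, h | lra]. Qed.

(** Under the integral sign the denominator [1 + s ^ 2] cancels, leaving [- 2 * x * exp (- x ^ 2) *
    exp (- (x * s) ^ 2)]; the substitution [u = x * s] then restores the integral from 0 to [x]. *)
Lemma is_derive_gauss_aux (x : R) :
  is_derive gauss_aux x (- 2 * exp (- x ^ 2) * RInt (fun u => exp (- u ^ 2)) 0 x).
Proof.
  assert (dE : forall u t, is_derive (fun z => exp (- (z ^ 2 * (1 + t ^ 2))) / (1 + t ^ 2)) u
                         (- 2 * u * exp (- (u ^ 2 * (1 + t ^ 2))))).
  { intros u t. assert (h := one_plus_sqr_pos t). auto_derive.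
    - simpl in h; lra.
    - simpl in *; field; lra. }
  replace (- 2 * exp (- x ^ 2) * RInt (fun u => exp (- u ^ 2)) 0 x)
    with (RInt (fun t => Derive (fun u => exp (- (u ^ 2 * (1 + t ^ 2))) / (1 + t ^ 2)) x) 0 1).
  - apply (is_derive_RInt_param (fun u t => exp (- (u ^ 2 * (1 + t ^ 2))) / (1 + t ^ 2))).
    + apply filter_forall; intros y t _. eexists; apply dE.
    + intros t _.
      apply continuity_2d_pt_ext with (fun u v => - 2 * u * exp (- (u ^ 2 * (1 + v ^ 2)))).
      { intros u v; symmetry; apply is_derive_unique, dE. }
      apply continuity_2d_pt_mult.
      * apply continuity_2d_pt_mult;
          [apply continuity_2d_pt_const | apply continuity_2d_pt_id1].
      * apply (continuity_1d_2d_pt_comp exp).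
        { apply derivable_continuous_pt, derivable_pt_exp. }
        simpl. apply continuity_2d_pt_opp.
        repeat first [apply continuity_2d_pt_mult | apply continuity_2d_pt_plus
          | apply continuity_2d_pt_const | apply continuity_2d_pt_id1
          | apply continuity_2d_pt_id2].
    + apply filter_forall; intros y. apply ex_RInt_gauss_aux.
  (* The shape [scal x (f (x * t + 0))] is the one [RInt_comp_lin] expects for the substitution
     [u = x * t]. *)
  - rewrite (RInt_ext _ (fun t => scal (- 2 * exp (- x ^ 2))
       (scal x (exp (- (x * t + 0) ^ 2))))).
    2:{ intros t _. etransitivity; [apply is_derive_unique, dE |].
        unfold scal; simpl; unfold mult; simpl.
        replace (- (x * (x * 1) * (1 + t * (t * 1))))
          with (- (x * (x * 1)) + - ((x * t + 0) * ((x * t + 0) * 1))) by ring.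
        rewrite exp_plus; ring. }
    assert (hi : ex_RInt (fun u => exp (- u ^ 2)) (x * 0 + 0) (x * 1 + 0))
      by apply ex_RInt_gauss.
    rewrite (@RInt_scal R_CompleteNormedModule).
    2:{ apply (@ex_RInt_comp_lin R_NormedModule (fun u => exp (- u ^ 2))), hi. }
    unfold scal at 1; simpl; unfold mult at 1; simpl. f_equal.
    etransitivity;
      [apply (@RInt_comp_lin R_CompleteNormedModule (fun u => exp (- u ^ 2)) x 0 0 1 hi) |].
    replace (x * 0 + 0) with 0 by ring. replace (x * 1 + 0) with x by ring. reflexivity.
Qed.

Lemma gauss_aux_0 : gauss_aux 0 = PI / 4.
Proof.
  unfold gauss_aux.
  rewrite (RInt_ext _ (fun s => / (1 + s²))).
  2:{ intros s _. replace (- (0 ^ 2 * (1 + s ^ 2))) with 0 by ring.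
      rewrite exp_0. unfold Rsqr. simpl. field. assert (h := one_plus_sqr_pos s); simpl in h; lra. }
  apply is_RInt_unique.
  replace (PI / 4) with (minus (atan 1) (atan 0)).
  2:{ rewrite atan_1, atan_0. unfold minus, plus, opp; simpl. ring. }
  apply (@is_RInt_derive R_CompleteNormedModule atan).
  - intros s _. apply is_derive_atan.
  - intros s _. apply (@ex_derive_continuous R_AbsRing R_NormedModule (fun s => / (1 + s²))).
    unfold Rsqr; auto_derive. assert (h := one_plus_sqr_pos s); simpl in h; lra.
Qed.

(** Since [1 + s ^ 2 >= 1], both the exponential and the quotient only decrease when it is replaced
    by its actual value; the bounds squeeze [gauss_aux] to 0 at infinity. *)
Lemma gauss_aux_bounds (x : R) : 0 <= gauss_aux x <= exp (- x ^ 2).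
Proof.
  split.
  - apply RInt_ge_0; [lra | apply ex_RInt_gauss_aux |].
    intros s _. assert (h := one_plus_sqr_pos s).
    apply Rlt_le, Rdiv_lt_0_compat; [apply exp_pos | exact h].
  - replace (exp (- x ^ 2)) with (RInt (fun _ => exp (- x ^ 2)) 0 1).
    2:{ rewrite RInt_const. unfold scal; simpl; unfold mult; simpl; ring. }
    apply RInt_le; [lra | apply ex_RInt_gauss_aux | apply ex_RInt_const |].
    intros s _. assert (h := one_plus_sqr_pos s).
    assert (hs := pow2_ge_0 s). assert (hx := pow2_ge_0 x).
    apply Rle_trans with (exp (- (x ^ 2 * (1 + s ^ 2)))).
    + rewrite <- (Rmult_1_r (exp (- (x ^ 2 * (1 + s ^ 2))))) at 2.
      apply Rmult_le_compat_l; [apply Rlt_le, exp_pos |].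
      rewrite <- Rinv_1. apply Rinv_le_contravar; lra.
    + apply exp_le_exp. nra.
Qed.

(** The sum of the square and [gauss_aux] has zero derivative, and its value at 0 is [PI / 4]. *)
Lemma gauss_sqr (x : R) : 0 < x ->
  (RInt (fun u => exp (- u ^ 2)) 0 x) ^ 2 = PI / 4 - gauss_aux x.
Proof.
  intros hx.
  assert (e : (fun y => (RInt (fun u => exp (- u ^ 2)) 0 y) ^ 2 + gauss_aux y) 0
            = (fun y => (RInt (fun u => exp (- u ^ 2)) 0 y) ^ 2 + gauss_aux y) x).
  { refine (@eq_is_derive R_NormedModule
      (fun y => (RInt (fun u => exp (- u ^ 2)) 0 y) ^ 2 + gauss_aux y) 0 x _ hx).
    intros t _.
    assert (d1 := is_derive_RInt_gauss t). assert (d2 := is_derive_gauss_aux t).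
    evar_last.
    - apply @is_derive_plus; [apply (is_derive_pow _ 2 _ _ d1) | exact d2].
    - unfold plus, zero; simpl. ring. }
  cbv beta in e. rewrite RInt_point, gauss_aux_0 in e. unfold zero in e; simpl in e. simpl.
  lra.
Qed.

(** * Monotonicity, limit, oddness and inverse of [erf] *)

Lemma two_div_sqrt_PI_pos : 0 < 2 / sqrt PI.
Proof. apply Rdiv_lt_0_compat; [lra | apply sqrt_lt_R0, PI_RGT_0]. Qed.

Lemma is_derive_erf (x : R) : is_derive erf x (2 / sqrt PI * exp (- x ^ 2)).
Proof. unfold erf. apply is_derive_scal, is_derive_RInt_gauss. Qed.

Lemma continuous_erf (x : R) : continuous erf x.
Proof.
  apply (@ex_derive_continuous R_AbsRing R_NormedModule). eexists; apply is_derive_erf.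
Qed.

Lemma continuity_pt_erf (x : R) : continuity_pt erf x.
Proof. apply continuity_pt_filterlim, continuous_erf. Qed.

Lemma erf_0 : erf 0 = 0.
Proof. unfold erf. rewrite RInt_point. unfold zero; simpl; ring. Qed.

Lemma erf_lt (x y : R) : x < y -> erf x < erf y.
Proof.
  intros h.
  apply (incr_function erf m_infty p_infty (fun x => 2 / sqrt PI * exp (- x ^ 2)));
    simpl; trivial.
  - intros; apply is_derive_erf.
  - intros; apply Rmult_lt_0_compat; [apply two_div_sqrt_PI_pos | apply exp_pos].
Qed.

Lemma erf_inj (x y : R) : erf x = erf y -> x = y.
Proof.
  intros h. destruct (Rtotal_order x y) as [l | [l | l]]; trivial; apply erf_lt in l; lra.
Qed.

Lemma erf_pos (x : R) : 0 < x -> 0 < erf x.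
Proof. intros h; rewrite <- erf_0; apply erf_lt, h. Qed.

Lemma erf_nonneg (x : R) : 0 <= x -> 0 <= erf x.
Proof. intros [h | <-]; [apply Rlt_le, erf_pos, h | rewrite erf_0; lra]. Qed.

Lemma is_lim_gauss : is_lim (fun x => exp (- x ^ 2)) p_infty 0.
Proof.
  apply is_lim_comp with m_infty.
  - apply is_lim_exp_m.
  - replace m_infty with (Rbar_opp p_infty) by reflexivity. apply is_lim_opp.
    apply is_lim_ext with (fun x => x * x); [intros; ring |].
    replace p_infty with (Rbar_mult p_infty p_infty) at 2 by reflexivity.
    apply is_lim_mult; try apply is_lim_id; exact I.
  - exists 0. intros y _; discriminate.
Qed.

(** For [x > 0] the integral is the positive square root of the right side of [gauss_sqr], in which
    [gauss_aux] tends to 0. *)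
Lemma is_lim_erf : is_lim erf p_infty 1.
Proof.
  assert (hPI := PI_RGT_0). assert (hsq := sqrt_lt_R0 _ hPI).
  assert (hl : is_lim gauss_aux p_infty 0).
  { apply is_lim_le_le_loc with (fun _ => 0) (fun x => exp (- x ^ 2)).
    - apply filter_forall; intros; apply gauss_aux_bounds.
    - apply is_lim_const.
    - apply is_lim_gauss. }
  apply is_lim_ext_loc with (fun x => 2 / sqrt PI * sqrt (PI / 4 - gauss_aux x)).
  { exists 0; intros x hx. rewrite <- gauss_sqr by exact hx.
    rewrite sqrt_pow2; [reflexivity |].
    assert (h := erf_pos x hx). assert (h' := two_div_sqrt_PI_pos). unfold erf in h.
    apply Rlt_le, (Rmult_lt_reg_l _ _ _ h'). lra. }
  replace (Finite 1) with (Rbar_mult (2 / sqrt PI) (sqrt (PI / 4 - 0))).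
  2:{ simpl. f_equal. rewrite Rminus_0_r. rewrite sqrt_div_alt by lra.
      replace (sqrt 4) with 2.
      - field; lra.
      - replace 4 with (2 * 2) by ring. rewrite sqrt_square; lra. }
  apply is_lim_scal_l.
  apply is_lim_comp_continuous.
  - replace (Finite (PI / 4 - 0)) with (Rbar_minus (PI / 4) 0) by reflexivity.
    apply is_lim_minus'; [apply is_lim_const | exact hl].
  - apply continuity_pt_filterlim. apply continuity_pt_sqrt. lra.
Qed.

Lemma erf_lt_1 (x : R) : erf x < 1.
Proof.
  apply Rlt_le_trans with (erf (x + 1)); [apply erf_lt; lra |].
  apply (is_lim_le_loc (fun _ => erf (x + 1)) erf p_infty (erf (x + 1)) 1).
  - exists (x + 1). intros y hy. apply Rlt_le, erf_lt, hy.
  - apply is_lim_const.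
  - apply is_lim_erf.
Qed.

Lemma erfc_pos (x : R) : 0 < erfc x.
Proof. unfold erfc; assert (h := erf_lt_1 x); lra. Qed.

(** [erf (- z) + erf z] has zero derivative and vanishes at 0. [eq_is_derive] asks for ordered end
    points, hence the reduction to positive arguments. *)
Lemma erf_opp (x : R) : erf (- x) = - erf x.
Proof.
  assert (h : forall y, 0 < y -> erf (- y) + erf y = 0).
  { intros y hy.
    assert (e : erf (- 0) + erf 0 = erf (- y) + erf y).
    { refine (@eq_is_derive R_NormedModule (fun z => erf (- z) + erf z) 0 y _ hy).
      intros t _. assert (d1 := is_derive_erf t). assert (d2 := is_derive_erf (- t)).
      evar_last.
      - apply @is_derive_plus; [| exact d1].
        apply (is_derive_comp erf Ropp); [exact d2 |].
        apply @is_derive_opp, @is_derive_id.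
      - unfold plus, scal, opp, zero, one; simpl; unfold mult; simpl.
        replace (- t * (- t * 1)) with (t * (t * 1)) by ring. ring. }
    rewrite Ropp_0, erf_0 in e. lra. }
  destruct (Rtotal_order x 0) as [hx | [-> | hx]].
  - specialize (h (- x) ltac:(lra)). rewrite Ropp_involutive in h. lra.
  - rewrite Ropp_0, erf_0. ring.
  - specialize (h x hx). lra.
Qed.

(** The choice made by [epsilon] is correct once a preimage exists: positive values are reached by
    the intermediate value theorem between 0 and infinity, negative ones by oddness. *)
Lemma erf_erfinv (y : R) : -1 < y < 1 -> erf (erfinv y) = y.
Proof.
  intros hy.
  assert (hpos : forall w, 0 < w < 1 -> exists x, erf x = w).
  { intros w hw.
    destruct (IVT_Rbar_incr erf 0 p_infty 0 1 w) as [x (_ & _ & hx)].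
    - rewrite <- erf_0 at 2. apply is_lim_continuity, continuity_pt_erf.
    - apply is_lim_erf.
    - intros; apply continuity_pt_erf.
    - exact I.
    - exact hw.
    - exists x; exact hx. }
  assert (hex : exists x, erf x = y).
  { destruct (Rtotal_order y 0) as [h | [-> | h]].
    - destruct (hpos (- y) ltac:(lra)) as [x hx]. exists (- x). rewrite erf_opp; lra.
    - exists 0; apply erf_0.
    - apply hpos; lra. }
  apply (epsilon_spec (inhabits 0) (fun x => erf x = y) hex).
Qed.

Lemma erfinv_erf (x : R) : erfinv (erf x) = x.
Proof.
  apply erf_inj. apply (epsilon_spec (inhabits 0) (fun z => erf z = erf x)).
  exists x; reflexivity.
Qed.

Lemma erfinv_lt (y z : R) : -1 < y -> y < z -> z < 1 -> erfinv y < erfinv z.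
Proof.
  intros h0 hyz h1. apply Rnot_le_lt; intros h.
  assert (h' : erf (erfinv z) <= erf (erfinv y)).
  { destruct h as [h | ->]; [apply Rlt_le, erf_lt, h | lra]. }
  rewrite !erf_erfinv in h'; lra.
Qed.

(** Inverse of a strictly increasing function: values strictly between [erf (x - eps)] and
    [erf (x + eps)] have their preimages within [eps] of [x]. *)
Lemma continuity_pt_erfinv (y : R) : -1 < y < 1 -> continuity_pt erfinv y.
Proof.
  intros hy. rewrite <- (erf_erfinv y) by lra.
  set (x := erfinv y).
  assert (hx : erf x = y) by (apply erf_erfinv; lra).
  apply continuity_pt_locally; intros eps. rewrite erfinv_erf, hx.
  assert (he := cond_pos eps).
  assert (h1 := erf_lt (x - eps) x ltac:(lra)).
  assert (h2 := erf_lt x (x + eps) ltac:(lra)).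
  (* The cuts at -1 and 1 keep [z] in the range where [erfinv] is specified. *)
  assert (hl : Rmax (-1) (erf (x - eps)) < y) by (apply Rmax_lub_lt; lra).
  assert (hr : y < Rmin 1 (erf (x + eps))) by (apply Rmin_glb_lt; lra).
  apply (filter_imp (fun z => Rmax (-1) (erf (x - eps)) < z /\ z < Rmin 1 (erf (x + eps)))).
  2:{ apply filter_and; [apply (open_gt _ y hl) | apply (open_lt _ y hr)]. }
  intros z [hz1 hz2].
  assert (ha := Rmax_l (-1) (erf (x - eps))). assert (hb := Rmax_r (-1) (erf (x - eps))).
  assert (hc := Rmin_l 1 (erf (x + eps))). assert (hd := Rmin_r 1 (erf (x + eps))).
  assert (hw : erf (erfinv z) = z) by (apply erf_erfinv; lra).
  apply Rabs_def1; apply Rnot_le_lt; intros h.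
  - assert (h' : x + eps <= erfinv z) by lra.
    destruct h' as [h' | h']; [apply erf_lt in h' | rewrite <- h' in hw]; lra.
  - assert (h' : erfinv z <= x - eps) by lra.
    destruct h' as [h' | h']; [apply erf_lt in h' | rewrite h' in hw]; lra.
Qed.

(** * The Gaussian tail bound and the ratio [exp (- x ^ 2) / erfc x] *)

(** The classical upper bound on the Mills ratio. It is what gives the derivative of
    [exp (- x ^ 2) / erfc x] its sign. *)
Lemma erfc_le_gauss (z : R) : 0 < z -> sqrt PI * z * erfc z <= exp (- z ^ 2).
Proof.
  intros hz.
  assert (hPI := PI_RGT_0). assert (hsq := sqrt_lt_R0 _ hPI).
  set (M := fun x => erfc x - exp (- x ^ 2) / (sqrt PI * x)).
  (* The excess [M] increases and tends to 0 at infinity. *)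
  assert (hM : forall w, z < w -> M z < M w).
  { intros w hw.
    apply (incr_function M 0 p_infty (fun x => exp (- x ^ 2) / (sqrt PI * x ^ 2))); simpl; trivial.
    - intros x hx _. unfold M, erfc.
      assert (de := is_derive_erf x).
      evar_last.
      + apply @is_derive_minus.
        * apply @is_derive_minus; [apply @is_derive_const | exact de].
        * instantiate (1 := - 2 * exp (- x ^ 2) / sqrt PI - exp (- x ^ 2) / (sqrt PI * x ^ 2)).
          auto_derive; [repeat split; nra |]. simpl; field. lra.
      + unfold minus, plus, opp, zero; simpl. field. lra.
    - intros x hx _. apply Rdiv_lt_0_compat; [apply exp_pos |].
      apply Rmult_lt_0_compat; nra. }
  (* For [w > z], [M z < M w < erfc w], and [erfc] tends to 0. *)
  assert (hMz : M z <= 0).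
  { apply (is_lim_le_loc (fun _ => M z) erfc p_infty (M z) 0).
    - exists z. intros w hw. apply Rlt_le, Rlt_le_trans with (M w); [apply hM, hw |].
      unfold M. assert (0 < exp (- w ^ 2) / (sqrt PI * w)); [| lra].
      apply Rdiv_lt_0_compat; [apply exp_pos | apply Rmult_lt_0_compat; lra].
    - apply is_lim_const.
    - replace (Finite 0) with (Rbar_minus 1 1) by (simpl; f_equal; ring).
      apply is_lim_minus'; [apply is_lim_const | apply is_lim_erf]. }
  unfold M in hMz.
  assert (hp : 0 < sqrt PI * z) by (apply Rmult_lt_0_compat; lra).
  apply (Rmult_le_compat_l _ _ _ (Rlt_le _ _ hp)) in hMz.
  replace (sqrt PI * z * (erfc z - exp (- z ^ 2) / (sqrt PI * z)))
    with (sqrt PI * z * erfc z - exp (- z ^ 2)) in hMz by (field; lra).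
  lra.
Qed.

Lemma is_derive_erfc (x : R) : is_derive erfc x (- (2 / sqrt PI * exp (- x ^ 2))).
Proof.
  unfold erfc. evar_last.
  - apply @is_derive_minus; [apply @is_derive_const | apply is_derive_erf].
  - unfold minus, plus, opp, zero; simpl; ring.
Qed.

Lemma is_derive_gauss_erfc (x : R) :
  is_derive (fun x => exp (- x ^ 2) / erfc x) x
    (2 * exp (- x ^ 2) * (exp (- x ^ 2) - sqrt PI * x * erfc x) / (sqrt PI * erfc x ^ 2)).
Proof.
  assert (hsq := sqrt_lt_R0 _ PI_RGT_0). assert (hc := erfc_pos x).
  assert (dg : is_derive (fun x => exp (- x ^ 2)) x (- 2 * x * exp (- x ^ 2))).
  { auto_derive; trivial. simpl; ring. }
  evar_last.
  - apply is_derive_div; [exact dg | apply is_derive_erfc | lra].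
  - unfold minus, plus, opp; simpl. field. lra.
Qed.

(** Mean value theorem, the factor [exp (- c ^ 2) - sqrt PI * c * erfc c] of the derivative being
    nonnegative by [erfc_le_gauss]. *)
Lemma gauss_erfc_le (x y : R) : 0 <= x <= y ->
  exp (- x ^ 2) / erfc x <= exp (- y ^ 2) / erfc y.
Proof.
  intros [hx [hxy | <-]]; [| lra].
  set (df := fun x => 2 * exp (- x ^ 2) * (exp (- x ^ 2) - sqrt PI * x * erfc x)
                      / (sqrt PI * erfc x ^ 2)).
  destruct (MVT_gen (fun x => exp (- x ^ 2) / erfc x) x y df) as [c [hc e]].
  - intros; apply is_derive_gauss_erfc.
  - intros z _. apply continuity_pt_filterlim.
    apply (@ex_derive_continuous R_AbsRing R_NormedModule (fun x => exp (- x ^ 2) / erfc x)).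
    eexists; apply is_derive_gauss_erfc.
  - cbv beta in e. rewrite Rmin_left, Rmax_right in hc by lra.
    assert (0 <= df c); [| nra].
    unfold df. assert (hE := exp_pos (- c ^ 2)). assert (hp := erfc_pos c).
    assert (hsq := sqrt_lt_R0 _ PI_RGT_0).
    apply Rmult_le_pos.
    + apply Rmult_le_pos; [lra |].
      (* [erfc_le_gauss] wants a positive argument; at [c = 0] the subtracted term vanishes. *)
      destruct (proj1 hc) as [h | h].
      * assert (h' := erfc_le_gauss c ltac:(lra)). lra.
      * destruct (Req_dec c 0) as [-> | hn]; [rewrite Rmult_0_r, Rmult_0_l; lra |].
        assert (h' := erfc_le_gauss c ltac:(lra)). lra.
    + apply Rlt_le, Rinv_0_lt_compat, Rmult_lt_0_compat; [lra | apply pow_lt, hp].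
Qed.


(** * The transcendental equation *)

Lemma pos_sqr (x : R) : 0 < x -> exists s, 0 < s /\ x = s * s.
Proof. intros h. exists (sqrt x). split; [apply sqrt_lt_R0, h | rewrite sqrt_sqrt; lra]. Qed.

Ltac positivity :=
  repeat match goal with
  | |- _ > 0 => apply Rlt_gt
  | |- 0 < _ * _ => apply Rmult_lt_0_compat
  | |- 0 < _ / _ => apply Rdiv_lt_0_compat
  | |- 0 < sqrt _ => apply sqrt_lt_R0
  | |- 0 < exp _ => apply exp_pos
  | |- 0 < erfc _ => apply erfc_pos
  | |- 0 < PI => apply PI_RGT_0
  | |- _ => first [assumption | lra]
  end.

Lemma alpha1_pos d : admissible d -> 0 < alpha1 d.
Proof. intros []; unfold alpha1; positivity. Qed.

Lemma alpha2_pos d : admissible d -> 0 < alpha2 d.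
Proof. intros []; unfold alpha2; positivity. Qed.

Lemma alpha3_pos d : admissible d -> 0 < alpha3 d.
Proof. intros []; unfold alpha3; positivity. Qed.

(* [k * d/dx erf (x / (2 sqrt (a t))) = flux k a / sqrt t] at [x = 0]. *)
Definition flux (k a : R) : R := k / sqrt (PI * a).

(* With the data written as squares, every [sqrt] of a quotient of data is a rational
   expression, and the identities between constants reduce to [field]. *)
Ltac square_roots d :=
  assert (hPI := PI_RGT_0); destruct (pos_sqr PI hPI) as [p [hp ep]];
  destruct d as [r0 x1 x2 x3 y1 y2 y3 m1 m2 b c dd ai hh]; simpl in *;
  destruct (pos_sqr r0) as [sr [hsr ->]]; [assumption |];
  destruct (pos_sqr x1) as [s1 [hs1 ->]]; [assumption |];
  destruct (pos_sqr x2) as [s2 [hs2 ->]]; [assumption |];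
  destruct (pos_sqr x3) as [s3 [hs3 ->]]; [assumption |];
  destruct (pos_sqr y1) as [q1 [hq1 ->]]; [assumption |];
  destruct (pos_sqr y2) as [q2 [hq2 ->]]; [assumption |];
  destruct (pos_sqr y3) as [q3 [hq3 ->]]; [assumption |].

(** The [match] backtracks over the square roots of the goal until it meets one whose argument is
    checked to be [v * v]. *)
Ltac sqrt_is v :=
  match goal with hp : PI = _ |- context [sqrt ?u] =>
    replace (sqrt u) with v by
      (apply eq_sym, sqrt_lem_1;
        [apply Rlt_le; positivity | apply Rlt_le; positivity |
         rewrite ?hp; field; repeat split; apply Rgt_not_eq; positivity])
  end.

(** * The constants of [phi], [H], [T] and [h2] in terms of [flux] *)

(** This identity and the next two give the constants the form in which the Stefan conditions
    produce them: a temperature difference times a flux, divided by the factor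
    [delta_i * sqrt alpha1] of the front speed. *)
Lemma Ste1_flux d : admissible d ->
  Ste1 d / sqrt PI = (tC d - tD d) * flux (k1 d) (alpha1 d) / (delta1 d * sqrt (alpha1 d)).
Proof.
  intros []. unfold Ste1, flux, alpha1, delta1. square_roots d.
  sqrt_is p. sqrt_is (p * (s1 / (sr * q1))). sqrt_is (s1 / (sr * q1)).
  field; repeat split; apply Rgt_not_eq; positivity.
Qed.

Lemma Ste2_flux d : admissible d ->
  Ste2 d / sqrt PI * (l2 d / l1 d) * sqrt (k2 d * c1 d / (k1 d * c2 d)) =
  (tB d - tC d) * flux (k2 d) (alpha2 d) / (delta1 d * sqrt (alpha1 d)).
Proof.
  intros []. unfold Ste2, flux, alpha2, alpha1, delta1. square_roots d.
  sqrt_is p. sqrt_is (s2 * q1 / (s1 * q2)). sqrt_is (p * (s2 / (sr * q2))).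
  sqrt_is (s1 / (sr * q1)).
  field; repeat split; apply Rgt_not_eq; positivity.
Qed.

Lemma Tfun_coef_flux d : admissible d ->
  Ste2 d / (sqrt PI * c2 d) * ((Ainf d - tB d) / (tB d - tC d))
    * sqrt (k3 d * c1 d * c3 d / k1 d) =
  (Ainf d - tB d) * flux (k3 d) (alpha3 d) / (delta2 d * sqrt (alpha1 d)).
Proof.
  intros []. unfold Ste2, flux, alpha3, alpha1, delta2. square_roots d.
  sqrt_is p. sqrt_is (s3 * q1 * q3 / s1). sqrt_is (p * (s3 / (sr * q3))).
  sqrt_is (s1 / (sr * q1)).
  field; repeat split; apply Rgt_not_eq; positivity.
Qed.

Lemma h2_flux d z : admissible d ->
  h2 d z = (tB d - tC d) / (Ainf d - tB d) * flux (k2 d) (alpha2 d)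
           * (1 / erf (z * sqrt (alpha1 d / alpha2 d))).
Proof.
  intros []. unfold h2. f_equal. f_equal. unfold flux, alpha3, alpha2. square_roots d.
  sqrt_is (s2 * q2 * sr / p). sqrt_is (p * (s2 / (sr * q2))).
  field; repeat split; apply Rgt_not_eq; positivity.
Qed.

Lemma flux_pos k a : 0 < k -> 0 < a -> 0 < flux k a.
Proof. intros; unfold flux; positivity. Qed.

Lemma Ste_pos d : admissible d -> 0 < Ste1 d /\ 0 < Ste2 d.
Proof. intros []; unfold Ste1, Ste2; split; positivity. Qed.

(** * Monotonicity of [phi], [Q], [H] and [T] *)

Lemma phi_gt d z : admissible d -> z < phi d z.
Proof.
  intros hd. destruct (Ste_pos d hd) as [h _].
  unfold phi. assert (0 < Ste1 d / sqrt PI * (exp (- z ^ 2) / erfc z)) by positivity. lra.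
Qed.

Lemma phi_lt d x y : admissible d -> 0 <= x < y -> phi d x < phi d y.
Proof.
  intros hd h. destruct (Ste_pos d hd) as [hs _].
  assert (hp : 0 < Ste1 d / sqrt PI) by positivity.
  assert (hg := gauss_erfc_le x y ltac:(lra)). unfold phi. nra.
Qed.

Lemma exp_sqr_le q x y : 0 < q -> 0 <= x < y -> exp (x ^ 2 * q) <= exp (y ^ 2 * q).
Proof. intros hq h. apply exp_le_exp. assert (x ^ 2 <= y ^ 2) by nra. nra. Qed.

Lemma Qfun_lt d x y : admissible d -> 0 <= x < y -> Qfun d x < Qfun d y.
Proof.
  intros hd h. assert (h1 := l1_pos _ hd). assert (h2 := l2_pos _ hd).
  assert (a1 := alpha1_pos d hd). assert (a2 := alpha2_pos d hd).
  assert (hq : 0 < alpha1 d / alpha2 d) by positivity.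
  assert (hl : 0 < l1 d / l2 d) by positivity.
  assert (hp := phi_lt d x y hd h). assert (hx := phi_gt d x hd).
  assert (he := exp_sqr_le _ x y hq h). assert (hpos := exp_pos (x ^ 2 * (alpha1 d / alpha2 d))).
  unfold Qfun. rewrite !Rmult_assoc. apply Rmult_lt_compat_l; [exact hl |]. nra.
Qed.

(** As [phi z > z] and the exponential is at least 1, [Q] has a linear minorant; it yields an
    explicit point where [Q] exceeds [T 0]. *)
Lemma Qfun_ge d z : admissible d -> 0 < z -> l1 d / l2 d * z <= Qfun d z.
Proof.
  intros hd h. assert (h1 := l1_pos _ hd). assert (h2 := l2_pos _ hd).
  assert (a1 := alpha1_pos d hd). assert (a2 := alpha2_pos d hd).
  assert (hq : 0 < alpha1 d / alpha2 d) by positivity.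
  assert (hl : 0 < l1 d / l2 d) by positivity.
  assert (hp := phi_gt d z hd).
  assert (he := exp_sqr_le _ 0 z hq ltac:(lra)).
  rewrite pow_i, Rmult_0_l, exp_0 in he by auto with arith.
  unfold Qfun. rewrite Rmult_assoc. apply Rmult_le_compat_l; [lra |]. nra.
Qed.

(** The [erf] term increases strictly; the subtracted fraction has a decreasing numerator and, by
    [phi_lt], an increasing denominator. *)
Lemma Hfun_lt d x y : admissible d -> 0 <= x < y -> Hfun d x < Hfun d y.
Proof.
  intros hd h.
  assert (a1 := alpha1_pos d hd). assert (a2 := alpha2_pos d hd).
  assert (hq : 0 < alpha1 d / alpha2 d) by positivity.
  assert (hs := sqrt_lt_R0 _ hq).
  assert (hp := phi_lt d x y hd h). assert (hx := phi_gt d x hd).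
  assert (h1 := l1_pos _ hd). assert (h2 := l2_pos _ hd).
  assert (hk1 := k1_pos _ hd). assert (hk2 := k2_pos _ hd).
  assert (hc1 := c1_pos _ hd). assert (hc2 := c2_pos _ hd).
  destruct (Ste_pos d hd) as [_ hs2].
  assert (he := erf_lt (x * sqrt (alpha1 d / alpha2 d)) (y * sqrt (alpha1 d / alpha2 d))
                  ltac:(nra)).
  assert (hK : 0 < Ste2 d / sqrt PI * (l2 d / l1 d) * sqrt (k2 d * c1 d / (k1 d * c2 d)))
    by positivity.
  unfold Hfun.
  assert (exp (- y ^ 2 * (alpha1 d / alpha2 d)) / phi d y
          <= exp (- x ^ 2 * (alpha1 d / alpha2 d)) / phi d x); [| nra].
  apply Rmult_le_compat.
  - apply Rlt_le, exp_pos.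
  - apply Rlt_le, Rinv_0_lt_compat; lra.
  - apply exp_le_exp. assert (x ^ 2 <= y ^ 2) by nra. nra.
  - apply Rinv_le_contravar; lra.
Qed.

(** Used twice: it gives [H < 1], so that [erfinv] can be applied, and it orders the fronts in
    [inner_lt_id]. *)
Lemma Hfun_lt_erf d z : admissible d -> 0 <= z ->
  Hfun d z < erf (z * sqrt (alpha1 d / alpha2 d)).
Proof.
  intros hd hz. assert (hp := phi_gt d z hd). assert (hp' : 0 < phi d z) by lra.
  destruct (Ste_pos d hd) as [_ hs2]. destruct hd.
  unfold Hfun.
  assert (0 < Ste2 d / sqrt PI * (l2 d / l1 d) * sqrt (k2 d * c1 d / (k1 d * c2 d))
    * (exp (- z ^ 2 * (alpha1 d / alpha2 d)) / phi d z)) by positivity.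
  lra.
Qed.

Lemma Tfun_denom_pos d z : admissible d -> 0 <= z ->
  0 < k3 d / (h0 d * sqrt (PI * alpha3 d)) + erf (z * sqrt (alpha1 d / alpha3 d)).
Proof.
  intros hd hz. assert (a3 := alpha3_pos d hd).
  assert (hk := k3_pos _ hd). assert (hh := h0_pos _ hd).
  assert (0 < k3 d / (h0 d * sqrt (PI * alpha3 d))) by positivity.
  assert (0 <= erf (z * sqrt (alpha1 d / alpha3 d))); [| lra].
  apply erf_nonneg, Rmult_le_pos; [exact hz | apply sqrt_pos].
Qed.

(** Since [alpha3 < alpha2], the coefficient [1 / alpha3 - 1 / alpha2] is positive and the
    exponential of the fraction decreases; its denominator and the subtracted term increase. *)
Lemma Tfun_lt d x y : admissible d -> tB d < Ainf d -> 0 <= x < y -> Tfun d y < Tfun d x.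
Proof.
  intros hd hA h.
  assert (a1 := alpha1_pos d hd). assert (a2 := alpha2_pos d hd).
  assert (a3 := alpha3_pos d hd).
  assert (hq : 0 < alpha1 d / alpha2 d) by positivity.
  assert (hs : 0 < sqrt (alpha1 d / alpha3 d)) by positivity.
  assert (hx := Tfun_denom_pos d x hd ltac:(lra)).
  assert (he := erf_lt (x * sqrt (alpha1 d / alpha3 d)) (y * sqrt (alpha1 d / alpha3 d))
                  ltac:(nra)).
  assert (hxy := exp_sqr_le _ x y hq h).
  assert (hpos := exp_pos (x ^ 2 * (alpha1 d / alpha2 d))).
  assert (hr : 0 < 1 / alpha3 d - 1 / alpha2 d).
  { assert (h32 := alpha3_lt_alpha2 _ hd).
    replace (1 / alpha3 d - 1 / alpha2 d) with ((alpha2 d - alpha3 d) / (alpha3 d * alpha2 d))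
      by (field; lra). positivity. }
  assert (hJ := flux_pos _ _ (k3_pos _ hd) a3).
  assert (hC : 0 < (Ainf d - tB d) * flux (k3 d) (alpha3 d) / (delta2 d * sqrt (alpha1 d))).
  { destruct hd. unfold delta2. positivity. }
  unfold Tfun. rewrite Tfun_coef_flux by exact hd.
  set (K := (Ainf d - tB d) * flux (k3 d) (alpha3 d) / (delta2 d * sqrt (alpha1 d))) in *.
  assert (hfrac : exp (- y ^ 2 * alpha1 d * (1 / alpha3 d - 1 / alpha2 d))
     / (k3 d / (h0 d * sqrt (PI * alpha3 d)) + erf (y * sqrt (alpha1 d / alpha3 d)))
     <= exp (- x ^ 2 * alpha1 d * (1 / alpha3 d - 1 / alpha2 d))
     / (k3 d / (h0 d * sqrt (PI * alpha3 d)) + erf (x * sqrt (alpha1 d / alpha3 d)))).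
  { apply Rmult_le_compat.
    - apply Rlt_le, exp_pos.
    - apply Rlt_le, Rinv_0_lt_compat; lra.
    - apply exp_le_exp. apply Rmult_le_compat_r; [lra |].
      apply Rmult_le_compat_r; [lra |]. nra.
    - apply Rinv_le_contravar; lra. }
  assert (hxe : x * exp (x ^ 2 * (alpha1 d / alpha2 d)) < y * exp (y ^ 2 * (alpha1 d / alpha2 d)))
    by nra.
  nra.
Qed.

(* [H z0 = 0] evaluates [Q z0], and the inequality becomes [h2 < h0]. *)
Lemma Qfun_lt_Tfun_0 d z0 : admissible d -> tB d < Ainf d -> 0 < z0 -> Hfun d z0 = 0 ->
  h2 d z0 < h0 d -> Qfun d z0 < Tfun d 0.
Proof.
  intros hd hA hz hH hh.
  assert (a1 := alpha1_pos d hd). assert (a2 := alpha2_pos d hd).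
  assert (a3 := alpha3_pos d hd).
  assert (hs : 0 < sqrt (alpha1 d / alpha2 d)) by positivity.
  assert (he : 0 < erf (z0 * sqrt (alpha1 d / alpha2 d))) by (apply erf_pos; positivity).
  rewrite h2_flux in hh by exact hd.
  unfold Hfun in hH. rewrite Ste2_flux in hH by exact hd.
  unfold Qfun, Tfun. rewrite Tfun_coef_flux by exact hd.
  assert (hp := phi_gt d z0 hd).
  assert (hJ2 := flux_pos _ _ (k2_pos _ hd) a2).
  assert (hJ3 := flux_pos _ _ (k3_pos _ hd) a3).
  replace (- z0 ^ 2 * (alpha1 d / alpha2 d)) with (- (z0 ^ 2 * (alpha1 d / alpha2 d))) in hH
    by ring.
  rewrite exp_Ropp in hH.
  assert (hE := exp_pos (z0 ^ 2 * (alpha1 d / alpha2 d))).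
  set (E := exp (z0 ^ 2 * (alpha1 d / alpha2 d))) in *.
  set (e := erf (z0 * sqrt (alpha1 d / alpha2 d))) in *.
  replace (k3 d / (h0 d * sqrt (PI * alpha3 d))) with (flux (k3 d) (alpha3 d) / h0 d).
  2:{ unfold flux. assert (hh0 := h0_pos _ hd).
      assert (0 < sqrt (PI * alpha3 d)) by positivity. field. lra. }
  replace (- 0 ^ 2 * alpha1 d * (1 / alpha3 d - 1 / alpha2 d)) with 0 by ring.
  rewrite !Rmult_0_l, erf_0, exp_0.
  set (J2 := flux (k2 d) (alpha2 d)) in *. set (J3 := flux (k3 d) (alpha3 d)) in *.
  assert (hsa : 0 < sqrt (alpha1 d)) by positivity. set (s := sqrt (alpha1 d)) in *.
  destruct hd as [hr _ _ _ _ _ _ hl1 hl2 hh0 hBC hCD _]. unfold delta1, delta2 in *.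
  assert (hP : phi d z0 * E = (tB d - tC d) * J2 / (rho d * l1 d * s) / e).
  { assert (e * (phi d z0 * E) = (tB d - tC d) * J2 / (rho d * l1 d * s)).
    { replace e with ((tB d - tC d) * J2 / (rho d * l1 d * s) * (/ E / phi d z0)) by lra.
      field. repeat split; lra. }
    rewrite <- H. field; lra. }
  rewrite Rmult_assoc, hP.
  (* This factor turns [h2] into [Q z0] and [h0] into [T 0]. *)
  apply Rmult_lt_compat_l with (r := (Ainf d - tB d) / (rho d * l2 d * s)) in hh;
    [| positivity].
  replace (l1 d / l2 d * ((tB d - tC d) * J2 / (rho d * l1 d * s) / e))
    with ((Ainf d - tB d) / (rho d * l2 d * s) * ((tB d - tC d) / (Ainf d - tB d) * J2 * (1 / e)))
    by (field; repeat split; lra).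
  replace ((Ainf d - tB d) * J3 / (rho d * l2 d * s) * (1 / (J3 / h0 d + 0)) - 0)
    with ((Ainf d - tB d) / (rho d * l2 d * s) * h0 d)
    by (rewrite Rplus_0_r; field; repeat split; lra).
  exact hh.
Qed.

(* [xi2] as a function of [xi1]. *)
Definition inner d z := sqrt (alpha2 d / alpha1 d) * erfinv (Hfun d z).

Lemma Hfun_range d z0 z : admissible d -> 0 < z0 -> Hfun d z0 = 0 -> z0 <= z -> 0 <= Hfun d z < 1.
Proof.
  intros hd h0 hH hz. split.
  - destruct hz as [hz | <-]; [| lra]. assert (h := Hfun_lt d z0 z hd ltac:(lra)). lra.
  - assert (h := Hfun_lt_erf d z hd ltac:(lra)).
    assert (h' := erf_lt_1 (z * sqrt (alpha1 d / alpha2 d))). lra.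
Qed.

Lemma sqrt_alpha_ratio_inv d : admissible d ->
  sqrt (alpha2 d / alpha1 d) * sqrt (alpha1 d / alpha2 d) = 1.
Proof.
  intros hd. assert (a1 := alpha1_pos d hd). assert (a2 := alpha2_pos d hd).
  rewrite <- sqrt_mult_alt by (apply Rlt_le; positivity).
  rewrite <- sqrt_1. f_equal. field; lra.
Qed.

Lemma inner_lt d z0 x y : admissible d -> 0 < z0 -> Hfun d z0 = 0 -> z0 <= x < y ->
  inner d x < inner d y.
Proof.
  intros hd h0 hH h. assert (a1 := alpha1_pos d hd). assert (a2 := alpha2_pos d hd).
  apply Rmult_lt_compat_l; [positivity |].
  assert (hx := Hfun_range d z0 x hd h0 hH ltac:(lra)).
  assert (hy := Hfun_range d z0 y hd h0 hH ltac:(lra)).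
  apply erfinv_lt; [lra | apply Hfun_lt; [exact hd | lra] | lra].
Qed.

Lemma inner_z0 d z0 : Hfun d z0 = 0 -> inner d z0 = 0.
Proof. intros hH. unfold inner. rewrite hH. rewrite <- erf_0 at 1. rewrite erfinv_erf. ring. Qed.

Lemma inner_nonneg d z0 z : admissible d -> 0 < z0 -> Hfun d z0 = 0 -> z0 <= z -> 0 <= inner d z.
Proof.
  intros hd h0 hH [h | <-]; rewrite <- (inner_z0 d z0 hH); [| lra].
  apply Rlt_le, (inner_lt d z0); trivial; lra.
Qed.

(** Thus [xi2 = inner d xi1] satisfies the first Stefan condition in its reduced form. *)
Lemma erf_inner d z0 z : admissible d -> 0 < z0 -> Hfun d z0 = 0 -> z0 <= z ->
  erf (inner d z * sqrt (alpha1 d / alpha2 d)) = Hfun d z.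
Proof.
  intros hd h0 hH hz. assert (h := Hfun_range d z0 z hd h0 hH hz).
  unfold inner. rewrite Rmult_comm, <- Rmult_assoc, (Rmult_comm (sqrt (alpha1 d / alpha2 d))).
  rewrite sqrt_alpha_ratio_inv, Rmult_1_l by exact hd. apply erf_erfinv; lra.
Qed.

Lemma inner_lt_id d z0 z : admissible d -> 0 < z0 -> Hfun d z0 = 0 -> z0 <= z -> inner d z < z.
Proof.
  intros hd h0 hH hz. assert (h := Hfun_lt_erf d z hd ltac:(lra)).
  rewrite <- (erf_inner d z0) in h by assumption.
  assert (a1 := alpha1_pos d hd). assert (a2 := alpha2_pos d hd).
  assert (hs : 0 < sqrt (alpha1 d / alpha2 d)) by positivity.
  apply Rnot_le_lt; intros [h' | h'].
  - assert (h'' := erf_lt (z * sqrt (alpha1 d / alpha2 d))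
      (inner d z * sqrt (alpha1 d / alpha2 d)) ltac:(nra)). lra.
  - rewrite <- h' in h. lra.
Qed.

Lemma ex_derive_continuity_pt (f : R -> R) x : ex_derive f x -> continuity_pt f x.
Proof.
  intros h. apply continuity_pt_filterlim, (@ex_derive_continuous R_AbsRing R_NormedModule f), h.
Qed.

Lemma ex_derive_erf x : ex_derive erf x.
Proof. eexists; apply is_derive_erf. Qed.

Lemma continuity_pt_Hfun d z : admissible d -> 0 < z -> continuity_pt (Hfun d) z.
Proof.
  intros hd h. apply ex_derive_continuity_pt.
  assert (hp := phi_gt d z hd). assert (hc := erfc_pos z).
  unfold Hfun, phi, erfc in *. auto_derive. repeat split; try apply ex_derive_erf; unfold Rdiv, Rminus in *; simpl in *; lra.
Qed.

Lemma continuity_pt_Qfun d z : admissible d -> continuity_pt (Qfun d) z.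
Proof.
  intros hd. apply ex_derive_continuity_pt. assert (hc := erfc_pos z).
  unfold Qfun, phi, erfc in *. auto_derive. repeat split; try apply ex_derive_erf; unfold Rdiv, Rminus in *; simpl in *; lra.
Qed.

Lemma continuity_pt_Tfun d z : admissible d -> 0 <= z -> continuity_pt (Tfun d) z.
Proof.
  intros hd h. apply ex_derive_continuity_pt. assert (hc := Tfun_denom_pos d z hd h).
  unfold Tfun in *. auto_derive. repeat split; try apply ex_derive_erf; unfold Rdiv, Rminus in *; simpl in *; lra.
Qed.

Lemma continuity_pt_inner d z0 z : admissible d -> 0 < z0 -> Hfun d z0 = 0 -> z0 <= z ->
  continuity_pt (inner d) z.
Proof.
  intros hd h0 hH hz. assert (h := Hfun_range d z0 z hd h0 hH hz).
  apply continuity_pt_scal. apply (continuity_pt_comp (Hfun d) erfinv).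
  - apply continuity_pt_Hfun; [exact hd | lra].
  - apply continuity_pt_erfinv; lra.
Qed.

Lemma unique_root d z0 : admissible d -> tB d < Ainf d -> 0 < z0 -> Hfun d z0 = 0 ->
  h2 d z0 < h0 d ->
  exists xi1, unique (fun z => z > z0 /\ Qfun d z = Tfun d (inner d z)) xi1.
Proof.
  intros hd hA hz hH hh.
  set (f := fun z => Qfun d z - Tfun d (inner d z)).
  assert (hcont : forall z, z0 <= z -> continuity_pt f z).
  { intros z hz'. apply continuity_pt_minus; [apply continuity_pt_Qfun, hd |].
    apply (continuity_pt_comp (inner d) (Tfun d)).
    - apply (continuity_pt_inner d z0); assumption.
    - apply continuity_pt_Tfun; [exact hd | apply (inner_nonneg d z0); assumption]. }
  assert (hincr : forall x y, z0 <= x < y -> f x < f y).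
  { intros x y h. assert (hq := Qfun_lt d x y hd ltac:(lra)).
    assert (hi := inner_lt d z0 x y hd hz hH h).
    assert (hn := inner_nonneg d z0 x hd hz hH ltac:(lra)).
    assert (ht := Tfun_lt d (inner d x) (inner d y) hd hA ltac:(lra)).
    unfold f; lra. }
  assert (hf0 : f z0 < 0).
  { unfold f. rewrite (inner_z0 d z0 hH).
    assert (h := Qfun_lt_Tfun_0 d z0 hd hA hz hH hh). lra. }
  assert (hl : 0 < l1 d / l2 d) by (destruct hd; positivity).
  (* The linear minorant of [Q] at [M] already exceeds [Rabs (T 0)], while [T (inner M) < T 0]; the
     summand [z0 + 1] makes both [M > z0] and the first comparison strict. *)
  set (M := z0 + 1 + Rabs (Tfun d 0) / (l1 d / l2 d)).
  assert (hM0 : 0 <= Rabs (Tfun d 0) / (l1 d / l2 d)).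
  { apply Rmult_le_pos; [apply Rabs_pos | apply Rlt_le, Rinv_0_lt_compat, hl]. }
  assert (hM : z0 < M) by (unfold M; lra).
  assert (hfM : 0 < f M).
  { assert (hq := Qfun_ge d M hd ltac:(lra)).
    assert (hi := inner_lt d z0 z0 M hd hz hH ltac:(lra)). rewrite (inner_z0 d z0 hH) in hi.
    assert (ht := Tfun_lt d 0 (inner d M) hd hA ltac:(lra)).
    assert (ha := Rle_abs (Tfun d 0)).
    assert (Rabs (Tfun d 0) < l1 d / l2 d * M); [| unfold f; lra].
    replace (Rabs (Tfun d 0)) with (l1 d / l2 d * (Rabs (Tfun d 0) / (l1 d / l2 d)))
      by (field; destruct hd; lra).
    apply Rmult_lt_compat_l; [exact hl | unfold M; lra]. }
  destruct (IVT_Rbar_incr f z0 M (f z0) (f M) 0) as [x (hx1 & hx2 & hx)].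
  - apply is_lim_continuity, hcont; lra.
  - apply is_lim_continuity, hcont; lra.
  - intros x h _. simpl in h. apply hcont; lra.
  - exact hM.
  - split; simpl; lra.
  - simpl in hx1. exists x. split.
    + split; [exact hx1 | unfold f in hx; lra].
    + intros y [hy hy'].
      assert (hfy : f y = 0) by (unfold f; lra).
      destruct (Rtotal_order x y) as [h | [h | h]]; trivial; exfalso.
      * assert (h' := hincr x y ltac:(lra)). lra.
      * assert (h' := hincr y x ltac:(lra)). lra.
Qed.


(** * Similarity profiles *)

Definition sim (a A B x t : R) : R := A + B * erf (x / (2 * sqrt (a * t))).

(** The [x]-derivative of [sim]; here [flux] takes the coefficient [B] in the place of a
    conductivity, and [mul_flux] exchanges the two. *)
Definition sim_dx (a B x t : R) : R :=
  flux B a / sqrt t * exp (- (x / (2 * sqrt (a * t))) ^ 2).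

Lemma is_derive_sim_x a A B x t : 0 < a -> 0 < t ->
  is_derive (fun z => sim a A B z t) x (sim_dx a B x t).
Proof.
  intros ha ht. assert (hPI := PI_RGT_0).
  assert (hs : 0 < sqrt (a * t)) by positivity.
  evar_last.
  - apply @is_derive_plus; [apply @is_derive_const |]. apply is_derive_scal.
    apply (is_derive_comp erf (fun z => z / (2 * sqrt (a * t)))); [apply is_derive_erf |].
    instantiate (1 := / (2 * sqrt (a * t))).
    auto_derive; [trivial | field; lra].
  - unfold sim_dx, flux, plus, zero, scal; simpl; unfold mult; simpl.
    rewrite !sqrt_mult_alt in * by lra.
    assert (0 < sqrt PI) by positivity. assert (0 < sqrt a) by positivity.
    assert (0 < sqrt t) by positivity.
    field; lra.
Qed.

Lemma Derive_sim_x a A B x t : 0 < a -> 0 < t ->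
  Derive (fun z => sim a A B z t) x = sim_dx a B x t.
Proof. intros; apply is_derive_unique, is_derive_sim_x; assumption. Qed.

Lemma is_derive_sim_dx a B x t : 0 < a -> 0 < t ->
  is_derive (fun z => sim_dx a B z t) x (- (x / (2 * (a * t))) * sim_dx a B x t).
Proof.
  intros ha ht. assert (hs : 0 < sqrt (a * t)) by positivity.
  unfold sim_dx. auto_derive; [trivial |].
  replace (2 * (a * t)) with (2 * (sqrt (a * t) * sqrt (a * t)))
    by (rewrite sqrt_sqrt; [reflexivity | nra]).
  simpl. unfold Rdiv. field. repeat split; apply Rgt_not_eq; positivity.
Qed.

(** The value is written as [a] times the derivative found in [is_derive_sim_dx], so that the heat
    equation can be read off. *)
Lemma is_derive_sim_t a A B x t : 0 < a -> 0 < t ->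
  is_derive (fun s => sim a A B x s) t (a * (- (x / (2 * (a * t))) * sim_dx a B x t)).
Proof.
  intros ha ht. assert (hPI := PI_RGT_0). assert (hat : 0 < a * t) by positivity.
  assert (hs : 0 < sqrt (a * t)) by positivity.
  evar_last.
  - apply @is_derive_plus; [apply @is_derive_const |]. apply is_derive_scal.
    apply (is_derive_comp erf (fun s => x / (2 * sqrt (a * s)))); [apply is_derive_erf |].
    instantiate (1 := - (x * a / (4 * (a * t) * sqrt (a * t)))).
    auto_derive; [repeat split; lra |].
    assert (e := sqrt_sqrt (a * t) ltac:(lra)). set (r := sqrt (a * t)) in *. rewrite <- e.
    field; lra.
  - unfold sim_dx, flux, plus, zero, scal; simpl; unfold mult; simpl.
    rewrite !sqrt_mult_alt in * by lra.
    assert (0 < sqrt PI) by positivity. assert (0 < sqrt a) by positivity.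
    assert (0 < sqrt t) by positivity.
    field; lra.
Qed.

Lemma heat_eq_sim a A B x t : 0 < a -> 0 < t -> heat_eq a (sim a A B) x t.
Proof.
  intros ha ht.
  assert (h2 : is_derive (Derive (fun z => sim a A B z t)) x
                 (- (x / (2 * (a * t))) * sim_dx a B x t)).
  { apply is_derive_ext with (fun z => sim_dx a B z t).
    - intros z; rewrite Derive_sim_x; trivial.
    - apply is_derive_sim_dx; assumption. }
  repeat split.
  - eexists; apply is_derive_sim_t; assumption.
  - eexists; apply is_derive_sim_x; assumption.
  - eexists; exact h2.
  - transitivity (a * (- (x / (2 * (a * t))) * sim_dx a B x t)).
    + apply is_derive_unique, is_derive_sim_t; assumption.
    + f_equal. symmetry. apply is_derive_unique, h2.
Qed.

(** Serves both limits of the outer phase: the argument of [erf] goes to infinity as [x] does, and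
    also as [t] tends to 0 from the right. *)
Lemma is_lim_erf_scal A B c : 0 < c -> is_lim (fun y => A + B * erf (c * y)) p_infty (A + B).
Proof.
  intros hc.
  replace (Finite (A + B)) with (Rbar_plus A (Rbar_mult B 1)) by (simpl; f_equal; ring).
  apply is_lim_plus'; [apply is_lim_const |].
  apply (is_lim_scal_l (fun y => erf (c * y)) B p_infty 1).
  apply is_lim_comp with p_infty.
  - apply is_lim_erf.
  - replace p_infty with (Rbar_mult c p_infty) at 2.
    + apply is_lim_scal_l, is_lim_id.
    + simpl. destruct (Rle_dec 0 c) as [h | h]; [| lra].
      destruct (Rle_lt_or_eq_dec 0 c h); [reflexivity | lra].
  - exists 0; intros; discriminate.
Qed.

Lemma is_lim_sim a A B t : 0 < a -> 0 < t -> is_lim (fun x => sim a A B x t) p_infty (A + B).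
Proof.
  intros ha ht. assert (hs : 0 < sqrt (a * t)) by positivity.
  apply is_lim_ext with (fun x => A + B * erf (/ (2 * sqrt (a * t)) * x)).
  - intros x. unfold sim. do 3 f_equal. field; lra.
  - apply is_lim_erf_scal, Rinv_0_lt_compat; lra.
Qed.

Lemma sim_initial a A B x : 0 < a -> 0 < x ->
  filterlim (fun t => sim a A B x t) (at_right 0) (locally (A + B)).
Proof.
  intros ha hx. assert (hs : 0 < sqrt a) by positivity.
  apply filterlim_ext_loc with (fun t => A + B * erf (x / (2 * sqrt a) * sqrt (/ t))).
  - exists (mkposreal 1 Rlt_0_1). intros t _ ht.
    assert (hst : 0 < sqrt t) by positivity.
    unfold sim. rewrite sqrt_mult_alt, sqrt_inv by lra. do 2 f_equal. f_equal. field; lra.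
  - apply (filterlim_comp _ _ _ Rinv
      (fun y => A + B * erf (x / (2 * sqrt a) * sqrt y)) _ (Rbar_locally p_infty)).
    + apply filterlim_Rinv_0_right.
    + apply (filterlim_comp _ _ _ sqrt
        (fun y => A + B * erf (x / (2 * sqrt a) * y)) _ (Rbar_locally p_infty)).
      * apply filterlim_sqrt_p.
      * apply is_lim_erf_scal. positivity.
Qed.

(** Agreement with the profile is asked on a neighbourhood of each [x] near [p], because [dx u] at
    [x] depends on the values of [u] around [x]. *)
Lemma trace_sim u a A B t p (F : (R -> Prop) -> Prop) {FF : Filter F} :
  0 < a -> 0 < t -> filter_le F (locally p) ->
  F (fun x => locally x (fun z => u z t = sim a A B z t)) ->
  trace u t F (sim a A B p t) /\ trace (dx u) t F (sim_dx a B p t).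
Proof.
  intros ha ht hF hu. split.
  - apply filterlim_ext_loc with (fun x => sim a A B x t).
    + revert hu. apply filter_imp. intros x hx. symmetry. apply (locally_singleton _ _ hx).
    + apply (filterlim_filter_le_1 _ hF).
      apply (@ex_derive_continuous R_AbsRing R_NormedModule (fun x => sim a A B x t)).
      eexists; apply is_derive_sim_x; assumption.
  - apply filterlim_ext_loc with (fun x => sim_dx a B x t).
    + revert hu. apply filter_imp. intros x hx. unfold dx.
      rewrite <- (Derive_sim_x a A B x t) by assumption. symmetry.
      apply Derive_ext_loc, hx.
    + apply (filterlim_filter_le_1 _ hF).
      apply (@ex_derive_continuous R_AbsRing R_NormedModule (fun x => sim_dx a B x t)).
      eexists; apply is_derive_sim_dx; assumption.
Qed.

Lemma locally_interval (P : R -> Prop) lo hi x :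
  (forall z, lo < z < hi -> P z) -> lo < x < hi -> locally x P.
Proof.
  intros hP hx. apply (filter_imp (fun z => lo < z /\ z < hi)); [exact hP |].
  apply filter_and; [apply (open_gt lo x) | apply (open_lt hi x)]; apply hx.
Qed.

Lemma at_right_interval (P : R -> Prop) lo hi : lo < hi ->
  (forall z, lo < z < hi -> P z) -> at_right lo (fun x => locally x P).
Proof.
  intros h hP. unfold at_right, within. apply (filter_imp (fun x => x < hi)).
  - intros x hx hlo. apply (locally_interval P lo hi); [exact hP | lra].
  - apply (open_lt hi lo h).
Qed.

Lemma at_left_interval (P : R -> Prop) lo hi : lo < hi ->
  (forall z, lo < z < hi -> P z) -> at_left hi (fun x => locally x P).
Proof.
  intros h hP. unfold at_left, within. apply (filter_imp (fun x => lo < x)).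
  - intros x hx hlo. apply (locally_interval P lo hi); [exact hP | lra].
  - apply (open_gt lo hi h).
Qed.

Lemma trace_right_sim u a A B t lo hi : 0 < a -> 0 < t -> lo < hi ->
  (forall z, lo < z < hi -> u z t = sim a A B z t) ->
  trace u t (at_right lo) (sim a A B lo t) /\ trace (dx u) t (at_right lo) (sim_dx a B lo t).
Proof.
  intros ha ht h hu. apply trace_sim; try assumption.
  - apply at_right_proper_filter.
  - apply filter_le_within.
  - apply (at_right_interval _ lo hi h hu).
Qed.

Lemma trace_left_sim u a A B t lo hi : 0 < a -> 0 < t -> lo < hi ->
  (forall z, lo < z < hi -> u z t = sim a A B z t) ->
  trace u t (at_left hi) (sim a A B hi t) /\ trace (dx u) t (at_left hi) (sim_dx a B hi t).
Proof.
  intros ha ht h hu. apply trace_sim; try assumption.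
  - apply at_left_proper_filter.
  - apply filter_le_within.
  - apply (at_left_interval _ lo hi h hu).
Qed.

Lemma trace_unique u t (F : (R -> Prop) -> Prop) {FF : ProperFilter' F} l l' :
  trace u t F l -> trace u t F l' -> l = l'.
Proof. apply (@filterlim_locally_unique R R_AbsRing R_NormedModule F FF (fun x => u x t)). Qed.

(** * The algebraic system for the coefficients *)

(** The similarity variable is constant along a front; this is why time drops out of the front
    conditions. *)
Lemma front_div d a xi t : admissible d -> 0 < a -> 0 < t ->
  front d xi t / (2 * sqrt (a * t)) = xi * sqrt (alpha1 d / a).
Proof.
  intros hd ha ht. assert (a1 := alpha1_pos d hd). unfold front.
  rewrite !sqrt_mult_alt, sqrt_div_alt by lra.
  assert (0 < sqrt a) by positivity. assert (0 < sqrt t) by positivity.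
  field; lra.
Qed.

Lemma sim_front d a A B xi t : admissible d -> 0 < a -> 0 < t ->
  sim a A B (front d xi t) t = A + B * erf (xi * sqrt (alpha1 d / a)).
Proof. intros; unfold sim; rewrite front_div by assumption; reflexivity. Qed.

Lemma sim_dx_front d a B xi t : admissible d -> 0 < a -> 0 < t ->
  sim_dx a B (front d xi t) t = flux B a / sqrt t * exp (- xi ^ 2 * (alpha1 d / a)).
Proof.
  intros hd ha ht. assert (a1 := alpha1_pos d hd). unfold sim_dx.
  rewrite front_div, Rpow_mult_distr, pow2_sqrt by (try assumption; apply Rlt_le; positivity).
  do 2 f_equal. ring.
Qed.

Lemma sim_0 a A B t : sim a A B 0 t = A.
Proof. unfold sim. rewrite Rdiv_0_l, erf_0. ring. Qed.

Lemma sim_dx_0 a B t : sim_dx a B 0 t = flux B a / sqrt t.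
Proof.
  unfold sim_dx. rewrite Rdiv_0_l. replace (- 0 ^ 2) with 0 by ring. rewrite exp_0. ring.
Qed.

Lemma alpha1_ratio d : admissible d -> alpha1 d / alpha1 d = 1.
Proof. intros hd. assert (h := alpha1_pos d hd). field; lra. Qed.

Lemma is_derive_front d xi t : admissible d -> 0 < t ->
  is_derive (front d xi) t (xi * sqrt (alpha1 d) / sqrt t).
Proof.
  intros hd ht. assert (a1 := alpha1_pos d hd). unfold front.
  assert (0 < alpha1 d * t) by positivity.
  auto_derive; [lra |]. rewrite sqrt_mult_alt by lra.
  assert (0 < sqrt (alpha1 d)) by positivity. assert (0 < sqrt t) by positivity.
  rewrite <- (sqrt_sqrt (alpha1 d)) at 1 by lra. field; lra.
Qed.

Lemma front_0 d xi : front d xi 0 = 0.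
Proof. unfold front. rewrite Rmult_0_r, sqrt_0. ring. Qed.

Lemma front_lt d xi xi' t : admissible d -> 0 < t -> xi < xi' -> front d xi t < front d xi' t.
Proof.
  intros hd ht h. assert (a1 := alpha1_pos d hd).
  assert (0 < sqrt (alpha1 d * t)) by positivity. unfold front. nra.
Qed.

Lemma front_pos d xi t : admissible d -> 0 < t -> 0 < xi -> 0 < front d xi t.
Proof.
  intros hd ht h. assert (a1 := alpha1_pos d hd). unfold front. positivity.
Qed.

(* The conditions of (P1) on the coefficients, with [sqrt t] cleared in the flux conditions. *)
Record balance (d : stefan_data) (A1 B1 A2 B2 A3 B3 xi1 xi2 : R) : Prop := Balance {
  bal_B3 : A3 + B3 * erf (xi2 * sqrt (alpha1 d / alpha3 d)) = tB d;
  bal_B2 : A2 + B2 * erf (xi2 * sqrt (alpha1 d / alpha2 d)) = tB d;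
  bal_C2 : A2 + B2 * erf (xi1 * sqrt (alpha1 d / alpha2 d)) = tC d;
  bal_C1 : A1 + B1 * erf xi1 = tC d;
  bal_D : A1 + B1 = tD d;
  bal_stefan2 : k2 d * (flux B2 (alpha2 d) * exp (- xi2 ^ 2 * (alpha1 d / alpha2 d)))
    - k3 d * (flux B3 (alpha3 d) * exp (- xi2 ^ 2 * (alpha1 d / alpha3 d)))
    = delta2 d * (xi2 * sqrt (alpha1 d));
  bal_stefan1 : k1 d * (flux B1 (alpha1 d) * exp (- xi1 ^ 2))
    - k2 d * (flux B2 (alpha2 d) * exp (- xi1 ^ 2 * (alpha1 d / alpha2 d)))
    = delta1 d * (xi1 * sqrt (alpha1 d));
  bal_robin : k3 d * flux B3 (alpha3 d) = h0 d * (A3 - Ainf d)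
}.

Lemma solves_P1_sim d A1 B1 A2 B2 A3 B3 xi1 xi2 : admissible d -> 0 < xi2 < xi1 ->
  balance d A1 B1 A2 B2 A3 B3 xi1 xi2 ->
  solves_P1 d (sim (alpha1 d) A1 B1) (sim (alpha2 d) A2 B2) (sim (alpha3 d) A3 B3)
    (front d xi1) (front d xi2).
Proof.
  intros hd hxi [hB3 hB2 hC2 hC1 hD hS2 hS1 hR].
  assert (a1 := alpha1_pos d hd). assert (a2 := alpha2_pos d hd).
  assert (a3 := alpha3_pos d hd).
  assert (hord : forall t, 0 < t -> 0 < front d xi2 t < front d xi1 t).
  { intros t ht. split; [apply front_pos | apply front_lt]; trivial; lra. }
  assert (T3l : forall t, 0 < t -> _) by
    (intros t ht; exact (trace_left_sim (sim (alpha3 d) A3 B3) (alpha3 d) A3 B3 t 0 (front d xi2 t)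
       a3 ht (proj1 (hord t ht)) (fun _ _ => eq_refl))).
  assert (T3r : forall t, 0 < t -> _) by
    (intros t ht; exact (trace_right_sim (sim (alpha3 d) A3 B3) (alpha3 d) A3 B3 t 0 (front d xi2 t)
       a3 ht (proj1 (hord t ht)) (fun _ _ => eq_refl))).
  assert (T2l : forall t, 0 < t -> _) by
    (intros t ht; exact (trace_left_sim (sim (alpha2 d) A2 B2) (alpha2 d) A2 B2 t
       (front d xi2 t) (front d xi1 t) a2 ht (proj2 (hord t ht)) (fun _ _ => eq_refl))).
  assert (T2r : forall t, 0 < t -> _) by
    (intros t ht; exact (trace_right_sim (sim (alpha2 d) A2 B2) (alpha2 d) A2 B2 t
       (front d xi2 t) (front d xi1 t) a2 ht (proj2 (hord t ht)) (fun _ _ => eq_refl))).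
  (* The outer phase is unbounded; [+ 1] picks an arbitrary right end for the one-sided
     neighbourhood. *)
  assert (T1r : forall t, 0 < t -> _) by
    (intros t ht; exact (trace_right_sim (sim (alpha1 d) A1 B1) (alpha1 d) A1 B1 t
       (front d xi1 t) (front d xi1 t + 1) a1 ht (Rlt_plus_1 _) (fun _ _ => eq_refl))).
  split.
  - exact hord.
  - intros; apply heat_eq_sim; assumption.
  - intros; apply heat_eq_sim; assumption.
  - intros; apply heat_eq_sim; assumption.
  - intros t ht. destruct (T3l t ht) as [h3 _]. destruct (T2r t ht) as [h2 _].
    rewrite sim_front in h2, h3 by assumption. rewrite hB3 in h3. rewrite hB2 in h2.
    split; assumption.
  - intros t ht. destruct (T2l t ht) as [h2 _]. destruct (T1r t ht) as [h1 _].
    rewrite sim_front in h2, h1 by assumption.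
    rewrite alpha1_ratio, sqrt_1, Rmult_1_r, hC1 in h1 by assumption. rewrite hC2 in h2.
    split; assumption.
  - intros x hx. rewrite <- hD. apply sim_initial; assumption.
  - intros t ht. rewrite <- hD. apply is_lim_sim; assumption.
  - intros t ht. destruct (T3l t ht) as [_ h3]. destruct (T2r t ht) as [_ h2].
    assert (hf := is_derive_front d xi2 t hd ht).
    eexists _, _. repeat split; [exact h2 | exact h3 | eexists; exact hf |].
    rewrite (is_derive_unique _ _ _ hf), !sim_dx_front by assumption.
    assert (0 < sqrt t) by positivity.
    (* Clears the factor [1 / sqrt t] shared by the fluxes and the front speed. *)
    apply Rmult_eq_reg_r with (sqrt t); [| lra].
    transitivity (delta2 d * (xi2 * sqrt (alpha1 d))); [rewrite <- hS2 |]; field; lra.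
  - intros t ht. destruct (T2l t ht) as [_ h2]. destruct (T1r t ht) as [_ h1].
    assert (hf := is_derive_front d xi1 t hd ht).
    eexists _, _. repeat split; [exact h1 | exact h2 | eexists; exact hf |].
    rewrite (is_derive_unique _ _ _ hf), !sim_dx_front, alpha1_ratio, Rmult_1_r by assumption.
    assert (0 < sqrt t) by positivity.
    apply Rmult_eq_reg_r with (sqrt t); [| lra].
    transitivity (delta1 d * (xi1 * sqrt (alpha1 d))); [rewrite <- hS1 |]; field; lra.
  - split; apply front_0.
  - intros t ht. destruct (T3r t ht) as [h3 h3'].
    eexists _, _. split; [exact h3 |]. split; [exact h3' |].
    rewrite sim_0, sim_dx_0. assert (0 < sqrt t) by positivity.
    apply Rmult_eq_reg_r with (sqrt t); [| lra].
    transitivity (h0 d * (A3 - Ainf d)); [rewrite <- hR |]; field; lra.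
Qed.

(** Time 1 suffices, since the unknown constants do not depend on [t]. Uniqueness of limits
    identifies the traces supplied by (P1) with those of the profiles. *)
Lemma balance_of_solution d Phi1 Phi2 Phi3 y1 y2 :
  admissible d -> similarity_solution d Phi1 Phi2 Phi3 y1 y2 ->
  exists A1 B1 A2 B2 A3 B3 xi1 xi2, 0 < xi2 < xi1 /\
    balance d A1 B1 A2 B2 A3 B3 xi1 xi2 /\
    same_solution Phi1 Phi2 Phi3 y1 y2
      (sim (alpha1 d) A1 B1) (sim (alpha2 d) A2 B2) (sim (alpha3 d) A3 B3)
      (front d xi1) (front d xi2).
Proof.
  intros hd [[[xi1 [xi2 [hxi hy]]] [[A1 [B1 h1]] [[A2 [B2 h2]] [A3 [B3 h3]]]]] hsol].
  exists A1, B1, A2, B2, A3, B3, xi1, xi2. split; [exact hxi |].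
  assert (a1 := alpha1_pos d hd). assert (a2 := alpha2_pos d hd).
  assert (a3 := alpha3_pos d hd). assert (H01 := Rlt_0_1).
  assert (hord := P1_order _ _ _ _ _ _ hsol 1 H01).
  destruct (hy 1 ltac:(lra)) as [e1 e2]. fold (front d xi1 1) (front d xi2 1) in e1, e2.
  split.
  - assert (T3l := trace_left_sim Phi3 (alpha3 d) A3 B3 1 0 (y2 1) a3 H01 (proj1 hord)
      (fun z hz => h3 1 z H01 hz)).
    assert (T3r := trace_right_sim Phi3 (alpha3 d) A3 B3 1 0 (y2 1) a3 H01 (proj1 hord)
      (fun z hz => h3 1 z H01 hz)).
    assert (T2l := trace_left_sim Phi2 (alpha2 d) A2 B2 1 (y2 1) (y1 1) a2 H01 (proj2 hord)
      (fun z hz => h2 1 z H01 hz)).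
    assert (T2r := trace_right_sim Phi2 (alpha2 d) A2 B2 1 (y2 1) (y1 1) a2 H01 (proj2 hord)
      (fun z hz => h2 1 z H01 hz)).
    assert (T1r := trace_right_sim Phi1 (alpha1 d) A1 B1 1 (y1 1) (y1 1 + 1) a1 H01
      (Rlt_plus_1 _) (fun z hz => h1 1 z H01 (proj1 hz))).
    rewrite e1, e2 in *.
    rewrite !sim_front, !sim_dx_front in * by assumption.
    rewrite sim_0, sim_dx_0, sqrt_1, !Rdiv_1_r in *.
    rewrite alpha1_ratio, sqrt_1, !Rmult_1_r in * by assumption.
    (* A front is prescribed only for [t >= 0], so its derivative at 1 is computed from agreement on
       the neighbourhood between 0 and 2. *)
    assert (hder : forall y xi, (forall t, 0 <= t -> y t = front d xi t) ->
              Derive y 1 = xi * sqrt (alpha1 d)).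
    { intros y xi hyx. rewrite (Derive_ext_loc y (front d xi)).
      - rewrite (is_derive_unique _ _ _ (is_derive_front d xi 1 hd H01)), sqrt_1. field.
      - apply (locally_interval _ 0 2); [intros z hz; apply hyx |]; lra. }
    assert (D1 := hder y1 xi1 (fun t ht => proj1 (hy t ht))).
    assert (D2 := hder y2 xi2 (fun t ht => proj2 (hy t ht))).
    destruct (P1_front2 _ _ _ _ _ _ hsol 1 H01) as [f3 f2].
    destruct (P1_front1 _ _ _ _ _ _ hsol 1 H01) as [f2' f1].
    destruct (P1_stefan2 _ _ _ _ _ _ hsol 1 H01) as [g2 [g3 [S2 [S3 [_ S]]]]].
    destruct (P1_stefan1 _ _ _ _ _ _ hsol 1 H01) as [g1 [g2' [S1 [S2' [_ S']]]]].
    destruct (P1_robin _ _ _ _ _ _ hsol 1 H01) as [p [g [R0 [R1 R2]]]].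
    rewrite e1, e2 in *. rewrite D2 in S. rewrite D1 in S'.
    rewrite sqrt_1, Rdiv_1_r in R2.
    split.
    + apply (trace_unique Phi3 1 (at_left (front d xi2 1))); [apply T3l | exact f3].
    + apply (trace_unique Phi2 1 (at_right (front d xi2 1))); [apply T2r | exact f2].
    + apply (trace_unique Phi2 1 (at_left (front d xi1 1))); [apply T2l | exact f2'].
    + apply (trace_unique Phi1 1 (at_right (front d xi1 1))); [apply T1r | exact f1].
    + assert (hlim := is_lim_sim (alpha1 d) A1 B1 1 a1 H01).
      apply (is_lim_ext_loc _ (fun x => Phi1 x 1)) in hlim.
      * assert (hlim' := P1_infinity _ _ _ _ _ _ hsol 1 H01).
        apply is_lim_unique in hlim. apply is_lim_unique in hlim'. congruence.
      * exists (front d xi1 1). intros x hx. symmetry. apply h1; [exact H01 | rewrite e1; exact hx].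
    + rewrite <- S. f_equal; f_equal.
      * apply (trace_unique (dx Phi2) 1 (at_right (front d xi2 1))); [apply T2r | exact S2].
      * apply (trace_unique (dx Phi3) 1 (at_left (front d xi2 1))); [apply T3l | exact S3].
    + rewrite <- S'. f_equal; f_equal.
      * apply (trace_unique (dx Phi1) 1 (at_right (front d xi1 1))); [apply T1r | exact S1].
      * apply (trace_unique (dx Phi2) 1 (at_left (front d xi1 1))); [apply T2l | exact S2'].
    + replace A3 with p.
      * rewrite <- R2. f_equal.
        apply (trace_unique (dx Phi3) 1 (at_right 0)); [apply T3r | exact R1].
      * apply (trace_unique Phi3 1 (at_right 0)); [exact R0 | apply T3r].
  - assert (hf : forall t, 0 <= t -> y1 t = front d xi1 t /\ y2 t = front d xi2 t) by exact hy.
    split; [exact hf |].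
    repeat split; intros t x ht hx; destruct (hf t ltac:(lra)) as [f1 f2];
      rewrite <- ?f1, <- ?f2 in hx; auto.
Qed.


(** * Elimination of the coefficients and the two Stefan conditions *)

(** [coef1], [coef2] and [coef3] are the values of [B1], [B2] and [B3] forced by the temperature and
    Robin conditions once [xi1] and [xi2] are given. *)
Definition coef1 d xi1 := - (tC d - tD d) / erfc xi1.

Definition coef2 d xi1 xi2 :=
  - (tB d - tC d)
  / (erf (xi1 * sqrt (alpha1 d / alpha2 d)) - erf (xi2 * sqrt (alpha1 d / alpha2 d))).

Definition coef3 d xi2 :=
  - (Ainf d - tB d)
  / (k3 d / (h0 d * sqrt (PI * alpha3 d)) + erf (xi2 * sqrt (alpha1 d / alpha3 d))).

Lemma erf_gap d xi1 xi2 : admissible d -> xi2 < xi1 ->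
  0 < erf (xi1 * sqrt (alpha1 d / alpha2 d)) - erf (xi2 * sqrt (alpha1 d / alpha2 d)).
Proof.
  intros hd h. assert (a1 := alpha1_pos d hd). assert (a2 := alpha2_pos d hd).
  assert (hs : 0 < sqrt (alpha1 d / alpha2 d)) by positivity.
  assert (he := erf_lt (xi2 * sqrt (alpha1 d / alpha2 d)) (xi1 * sqrt (alpha1 d / alpha2 d))
                  ltac:(nra)). lra.
Qed.

Lemma mul_flux k B a E : k * (flux B a * E) = B * flux k a * E.
Proof. unfold flux, Rdiv; ring. Qed.

(** Origin of the constant [k3 / (h0 * sqrt (PI * alpha3))] in [T] and [v3]: the Robin condition
    makes it the ratio of [A3 - Ainf] to [B3]. *)
Lemma robin_flux d A3 B3 : admissible d ->
  k3 d * flux B3 (alpha3 d) = h0 d * (A3 - Ainf d) <->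
  A3 = Ainf d + k3 d / (h0 d * sqrt (PI * alpha3 d)) * B3.
Proof.
  intros hd. assert (a3 := alpha3_pos d hd). assert (hh := h0_pos _ hd).
  assert (hs : 0 < sqrt (PI * alpha3 d)) by positivity.
  assert (e : k3 d * flux B3 (alpha3 d)
              = h0 d * (k3 d / (h0 d * sqrt (PI * alpha3 d)) * B3))
    by (unfold flux; field; lra).
  rewrite e. split.
  - intros h. apply Rmult_eq_reg_l in h; lra.
  - intros ->. ring.
Qed.

(** One linear system of two equations per phase; up to sign the determinants are [erfc xi1], the
    gap of [erf_gap] and the denominator of [T], all positive. *)
Lemma balance_coefs d A1 B1 A2 B2 A3 B3 xi1 xi2 : admissible d -> 0 < xi2 < xi1 ->
  balance d A1 B1 A2 B2 A3 B3 xi1 xi2 ->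
  (A1 = tD d - coef1 d xi1 /\ B1 = coef1 d xi1) /\
  (A2 = tB d - coef2 d xi1 xi2 * erf (xi2 * sqrt (alpha1 d / alpha2 d)) /\
   B2 = coef2 d xi1 xi2) /\
  (A3 = Ainf d + k3 d / (h0 d * sqrt (PI * alpha3 d)) * coef3 d xi2 /\ B3 = coef3 d xi2).
Proof.
  intros hd hxi [hB3 hB2 hC2 hC1 hD _ _ hR].
  assert (g := erf_gap d xi1 xi2 hd ltac:(lra)).
  assert (m := Tfun_denom_pos d xi2 hd ltac:(lra)).
  assert (c := erfc_pos xi1).
  apply robin_flux in hR; [| exact hd].
  assert (e1 : B1 = coef1 d xi1).
  { unfold coef1. replace (tC d - tD d) with (- (B1 * erfc xi1)) by (unfold erfc; lra).
    field; lra. }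
  assert (e2 : B2 = coef2 d xi1 xi2).
  { unfold coef2. rewrite <- hB2 at 1. rewrite <- hC2. field; lra. }
  assert (e3 : B3 = coef3 d xi2).
  { unfold coef3. set (r := k3 d / (h0 d * sqrt (PI * alpha3 d))) in *.
    rewrite <- hB3, hR. field; lra. }
  rewrite <- e1, <- e2, <- e3. repeat split; lra.
Qed.

(** With [phi xi1 = xi1 + P], the flux of the outer phase is [- P * (delta1 * sqrt alpha1)], so both
    sides amount to [(tB - tC) * J2 * E = (e1 - e2) * (xi1 + P) * (delta1 * sqrt alpha1)]; [H] is
    this relation solved for [e2]. *)
Lemma Hfun_iff_stefan1 d xi1 xi2 : admissible d -> 0 < xi2 < xi1 ->
  k1 d * (flux (coef1 d xi1) (alpha1 d) * exp (- xi1 ^ 2))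
    - k2 d * (flux (coef2 d xi1 xi2) (alpha2 d) * exp (- xi1 ^ 2 * (alpha1 d / alpha2 d)))
    = delta1 d * (xi1 * sqrt (alpha1 d)) <->
  Hfun d xi1 = erf (xi2 * sqrt (alpha1 d / alpha2 d)).
Proof.
  intros hd hxi.
  assert (a1 := alpha1_pos d hd).
  assert (g := erf_gap d xi1 xi2 hd ltac:(lra)). assert (c := erfc_pos xi1).
  assert (hp := phi_gt d xi1 hd).
  unfold Hfun. rewrite Ste2_flux by exact hd. unfold phi in *. rewrite Ste1_flux in * by exact hd.
  rewrite (mul_flux (k1 d)), (mul_flux (k2 d)). unfold coef1, coef2.
  assert (hs : 0 < sqrt (alpha1 d)) by positivity.
  assert (hdl : 0 < delta1 d) by (destruct hd; unfold delta1; positivity).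
  set (e1 := erf (xi1 * sqrt (alpha1 d / alpha2 d))) in *.
  set (e2 := erf (xi2 * sqrt (alpha1 d / alpha2 d))) in *.
  set (E := exp (- xi1 ^ 2 * (alpha1 d / alpha2 d))).
  set (J2 := flux (k2 d) (alpha2 d)).
  set (P := (tC d - tD d) * flux (k1 d) (alpha1 d) / (delta1 d * sqrt (alpha1 d))
            * (exp (- xi1 ^ 2) / erfc xi1)) in *.
  replace (- (tC d - tD d) / erfc xi1 * flux (k1 d) (alpha1 d) * exp (- xi1 ^ 2))
    with (- (P * (delta1 d * sqrt (alpha1 d)))) by (unfold P; field; lra).
  split; intros h.
  - assert (h' : (tB d - tC d) * J2 * E
                 = (e1 - e2) * (xi1 + P) * (delta1 d * sqrt (alpha1 d))).
    { replace ((tB d - tC d) * J2 * E)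
        with ((e1 - e2) * - (- (tB d - tC d) / (e1 - e2) * J2 * E)) by (field; lra).
      rewrite (Rmult_assoc (e1 - e2)). f_equal. lra. }
    replace ((tB d - tC d) * J2 / (delta1 d * sqrt (alpha1 d)) * (E / (xi1 + P)))
      with ((tB d - tC d) * J2 * E / ((xi1 + P) * (delta1 d * sqrt (alpha1 d))))
      by (field; repeat split; lra).
    rewrite h'. field. repeat split; lra.
  - assert (h' : (tB d - tC d) * J2 * E
                 = (e1 - e2) * (xi1 + P) * (delta1 d * sqrt (alpha1 d))).
    { replace (e1 - e2)
        with ((tB d - tC d) * J2 / (delta1 d * sqrt (alpha1 d)) * (E / (xi1 + P))) by lra.
      field. repeat split; lra. }
    replace (- (tB d - tC d) / (e1 - e2) * J2 * E)
      with (- ((tB d - tC d) * J2 * E / (e1 - e2))) by (field; lra).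
    rewrite h'. field. lra.
Qed.

(** The second Stefan condition contains [xi1] only through the gap [e1 - e2], which the first
    condition expresses by [phi xi1]; that is how [Q xi1] appears. *)
Lemma Qfun_iff_stefan2 d xi1 xi2 : admissible d -> 0 < xi2 < xi1 ->
  Hfun d xi1 = erf (xi2 * sqrt (alpha1 d / alpha2 d)) ->
  k2 d * (flux (coef2 d xi1 xi2) (alpha2 d) * exp (- xi2 ^ 2 * (alpha1 d / alpha2 d)))
    - k3 d * (flux (coef3 d xi2) (alpha3 d) * exp (- xi2 ^ 2 * (alpha1 d / alpha3 d)))
    = delta2 d * (xi2 * sqrt (alpha1 d)) <->
  Qfun d xi1 = Tfun d xi2.
Proof.
  intros hd hxi hH.
  assert (a1 := alpha1_pos d hd). assert (a2 := alpha2_pos d hd).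
  assert (a3 := alpha3_pos d hd).
  assert (g := erf_gap d xi1 xi2 hd ltac:(lra)).
  assert (m := Tfun_denom_pos d xi2 hd ltac:(lra)).
  assert (hp := phi_gt d xi1 hd).
  unfold Hfun in hH. rewrite Ste2_flux in hH by exact hd.
  unfold Qfun, Tfun. rewrite Tfun_coef_flux by exact hd.
  rewrite (mul_flux (k2 d)), (mul_flux (k3 d)). unfold coef2, coef3.
  assert (hs : 0 < sqrt (alpha1 d)) by positivity.
  assert (hl1 := l1_pos _ hd). assert (hl2 := l2_pos _ hd). assert (hr := rho_pos _ hd).
  replace (- xi2 ^ 2 * alpha1 d * (1 / alpha3 d - 1 / alpha2 d))
    with (- xi2 ^ 2 * (alpha1 d / alpha3 d) + xi2 ^ 2 * (alpha1 d / alpha2 d)) by (field; lra).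
  rewrite exp_plus.
  replace (- xi2 ^ 2 * (alpha1 d / alpha2 d)) with (- (xi2 ^ 2 * (alpha1 d / alpha2 d))) by ring.
  replace (- xi1 ^ 2 * (alpha1 d / alpha2 d)) with (- (xi1 ^ 2 * (alpha1 d / alpha2 d))) in hH
    by ring.
  rewrite exp_Ropp in *.
  assert (hE1 := exp_pos (xi1 ^ 2 * (alpha1 d / alpha2 d))).
  assert (hE2 := exp_pos (xi2 ^ 2 * (alpha1 d / alpha2 d))).
  set (E1 := exp (xi1 ^ 2 * (alpha1 d / alpha2 d))) in *.
  set (E2 := exp (xi2 ^ 2 * (alpha1 d / alpha2 d))) in *.
  set (E3 := exp (- xi2 ^ 2 * (alpha1 d / alpha3 d))).
  set (e1 := erf (xi1 * sqrt (alpha1 d / alpha2 d))) in *.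
  set (e2 := erf (xi2 * sqrt (alpha1 d / alpha2 d))) in *.
  set (M := k3 d / (h0 d * sqrt (PI * alpha3 d)) + erf (xi2 * sqrt (alpha1 d / alpha3 d))) in *.
  set (J2 := flux (k2 d) (alpha2 d)) in *. set (J3 := flux (k3 d) (alpha3 d)).
  unfold delta1, delta2 in *. set (s := sqrt (alpha1 d)) in *.
  assert (hgap : (tB d - tC d) * J2 = (e1 - e2) * phi d xi1 * E1 * (rho d * l1 d * s)).
  { replace (e1 - e2)
      with ((tB d - tC d) * J2 / (rho d * l1 d * s) * (/ E1 / phi d xi1)) by lra.
    field. repeat split; lra. }
  (* The defect of the Stefan condition is a positive multiple of [T xi2 - Q xi1]. *)
  assert (e : - (tB d - tC d) / (e1 - e2) * J2 * / E2
              - - (Ainf d - tB d) / M * J3 * E3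
              - rho d * l2 d * (xi2 * s)
            = rho d * l2 d * s / E2
              * ((Ainf d - tB d) * J3 / (rho d * l2 d * s) * (E3 * E2 / M) - xi2 * E2
                 - l1 d / l2 d * phi d xi1 * E1)).
  { replace (- (tB d - tC d) / (e1 - e2) * J2 * / E2)
      with (- ((tB d - tC d) * J2) / (e1 - e2) / E2) by (field; lra).
    rewrite hgap. field. repeat split; lra. }
  assert (hK : 0 < rho d * l2 d * s / E2) by positivity.
  split; intros h.
  - assert (h' : rho d * l2 d * s / E2
              * ((Ainf d - tB d) * J3 / (rho d * l2 d * s) * (E3 * E2 / M) - xi2 * E2
                 - l1 d / l2 d * phi d xi1 * E1) = 0) by lra.
    apply Rmult_integral in h'. lra.
  - replace ((Ainf d - tB d) * J3 / (rho d * l2 d * s) * (E3 * E2 / M) - xi2 * E2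
                 - l1 d / l2 d * phi d xi1 * E1) with 0 in e by lra.
    lra.
Qed.

(** * The closed forms, existence and uniqueness *)

(** The closed forms equal the profiles as total functions, also outside their regions, so they can
    be rewritten in the theorem. *)
Lemma v1_sim d xi1 : v1 d xi1 = sim (alpha1 d) (tD d - coef1 d xi1) (coef1 d xi1).
Proof.
  apply functional_extensionality; intros x. apply functional_extensionality; intros t.
  assert (c := erfc_pos xi1). unfold v1, sim, coef1.
  replace (erf xi1) with (1 - erfc xi1) by (unfold erfc; ring). field; lra.
Qed.

Lemma v2_sim d xi1 xi2 : admissible d -> xi2 < xi1 ->
  v2 d xi1 xi2 = sim (alpha2 d)
    (tB d - coef2 d xi1 xi2 * erf (xi2 * sqrt (alpha1 d / alpha2 d))) (coef2 d xi1 xi2).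
Proof.
  intros hd h. assert (g := erf_gap d xi1 xi2 hd h).
  apply functional_extensionality; intros x. apply functional_extensionality; intros t.
  unfold v2, sim, coef2. field; lra.
Qed.

Lemma v3_sim d xi2 : admissible d -> 0 < xi2 ->
  v3 d xi2 = sim (alpha3 d)
    (Ainf d + k3 d / (h0 d * sqrt (PI * alpha3 d)) * coef3 d xi2) (coef3 d xi2).
Proof.
  intros hd h. assert (m := Tfun_denom_pos d xi2 hd ltac:(lra)).
  apply functional_extensionality; intros x. apply functional_extensionality; intros t.
  unfold v3, sim, coef3. set (r := k3 d / (h0 d * sqrt (PI * alpha3 d))) in *. field; lra.
Qed.

Lemma balance_of_roots d xi1 xi2 : admissible d -> 0 < xi2 < xi1 ->
  Hfun d xi1 = erf (xi2 * sqrt (alpha1 d / alpha2 d)) -> Qfun d xi1 = Tfun d xi2 ->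
  balance d (tD d - coef1 d xi1) (coef1 d xi1)
    (tB d - coef2 d xi1 xi2 * erf (xi2 * sqrt (alpha1 d / alpha2 d))) (coef2 d xi1 xi2)
    (Ainf d + k3 d / (h0 d * sqrt (PI * alpha3 d)) * coef3 d xi2) (coef3 d xi2) xi1 xi2.
Proof.
  intros hd hxi hH hQ.
  assert (g := erf_gap d xi1 xi2 hd ltac:(lra)).
  assert (m := Tfun_denom_pos d xi2 hd ltac:(lra)).
  assert (c := erfc_pos xi1).
  split.
  - unfold coef3. set (r := k3 d / (h0 d * sqrt (PI * alpha3 d))) in *. field; lra.
  - ring.
  - unfold coef2. field; lra.
  - unfold coef1. replace (erf xi1) with (1 - erfc xi1) by (unfold erfc; ring). field; lra.
  - ring.
  - apply Qfun_iff_stefan2; assumption.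
  - apply Hfun_iff_stefan1; assumption.
  - apply robin_flux; [assumption | reflexivity].
Qed.

Theorem theorem2p1 (d : stefan_data) (hd : admissible d)
  (z0 : R) (hz0 : 0 < z0) (hHz0 : Hfun d z0 = 0)
  (hA : Ainf d > tB d) (hh : h0 d > h2 d z0) :
  exists xi1 xi2 : R,
    unique (fun z => z > z0 /\
                     Qfun d z = Tfun d (sqrt (alpha2 d / alpha1 d) * erfinv (Hfun d z))) xi1 /\
    xi2 = sqrt (alpha2 d / alpha1 d) * erfinv (Hfun d xi1) /\
    similarity_solution d (v1 d xi1) (v2 d xi1 xi2) (v3 d xi2) (front d xi1) (front d xi2) /\
    (forall (Phi1 Phi2 Phi3 : R -> R -> R) (y1 y2 : R -> R),
       similarity_solution d Phi1 Phi2 Phi3 y1 y2 ->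
       same_solution Phi1 Phi2 Phi3 y1 y2
         (v1 d xi1) (v2 d xi1 xi2) (v3 d xi2) (front d xi1) (front d xi2)).
Proof.
  assert (a1 := alpha1_pos d hd). assert (a2 := alpha2_pos d hd).
  assert (hr : 0 < sqrt (alpha1 d / alpha2 d)) by positivity.
  destruct (unique_root d z0 hd hA hz0 hHz0 hh) as [xi1 hu].
  assert (hu' := hu). destruct hu' as [[hxi1 hQ] huniq].
  exists xi1, (inner d xi1). split; [exact hu |]. split; [reflexivity |].
  assert (hxi : 0 < inner d xi1 < xi1).
  { split.
    - rewrite <- (inner_z0 d z0 hHz0). apply (inner_lt d z0); trivial; lra.
    - apply (inner_lt_id d z0); trivial; lra. }
  assert (hH : Hfun d xi1 = erf (inner d xi1 * sqrt (alpha1 d / alpha2 d)))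
    by (symmetry; apply (erf_inner d z0); trivial; lra).
  rewrite v1_sim, v2_sim, v3_sim by (trivial; lra).
  split; [split |].
  - split; [| repeat split; eexists _, _; intros; reflexivity].
    exists xi1, (inner d xi1). split; [exact hxi | split; reflexivity].
  - apply solves_P1_sim; [exact hd | exact hxi |]. apply balance_of_roots; assumption.
  - intros Phi1 Phi2 Phi3 y1 y2 hsol.
    destruct (balance_of_solution d Phi1 Phi2 Phi3 y1 y2 hd hsol)
      as (A1 & B1 & A2 & B2 & A3 & B3 & x1 & x2 & hx & hb & hsame).
    destruct (balance_coefs _ _ _ _ _ _ _ _ _ hd hx hb) as [[-> ->] [[-> ->] [-> ->]]].
    assert (hH' := bal_stefan1 _ _ _ _ _ _ _ _ _ hb).
    apply Hfun_iff_stefan1 in hH'; [| exact hd | exact hx].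
    assert (hQ' := bal_stefan2 _ _ _ _ _ _ _ _ _ hb).
    apply Qfun_iff_stefan2 in hQ'; [| exact hd | exact hx | exact hH'].
    (* As [x2 > 0], [H x1 = erf (x2 * r)] is positive, whereas [H <= 0] on the interval from 0 to
       [z0]. *)
    assert (hx1 : z0 < x1).
    { apply Rnot_le_lt; intros h.
      assert (hpos : 0 < erf (x2 * sqrt (alpha1 d / alpha2 d)))
        by (apply erf_pos, Rmult_lt_0_compat; lra).
      destruct h as [h | h].
      - assert (h' := Hfun_lt d x1 z0 hd ltac:(lra)). lra.
      - rewrite h in hH'. lra. }
    (* Apply [erfinv] to [H x1 = erf (x2 * r)]; the two square roots of ratios are inverse to each
       other. *)
    assert (hx2 : x2 = inner d x1).
    { unfold inner. rewrite hH', erfinv_erf.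
      rewrite (Rmult_comm x2), <- Rmult_assoc, sqrt_alpha_ratio_inv by exact hd. ring. }
    assert (e : xi1 = x1).
    { apply huniq. split; [lra |]. fold (inner d x1). rewrite <- hx2. exact hQ'. }
    rewrite hx2, <- e in hsame. exact hsame.
Qed.
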